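(* Let $v$ be a valuation on $\overline{K}(X)$ and suppose that the extension $(K(X)|K,v)$ is valuation algebraic. Fix an extension of $v$ to an algebraic closure $\overline{K(X)}$ of $K(X)$ containing $\overline{K}(X)$. Let $\lambda$ be a limit ordinal and let $\{\gamma_\nu\}_{\nu<\lambda}\subseteq v(X-\overline{K}):=\{v(X-a)\mid a\in\overline{K}\}$ and $\{a_\nu\}_{\nu<\lambda}\subseteq\overline{K}$ be sequences such that (i) $\gamma_\nu<\gamma_\mu$ for all $\nu<\mu<\lambda$, and $\{\gamma_\nu\}_{\nu<\lambda}$ is cofinal in $v(X-\overline{K})$; and for all $\nu<\lambda$: (ii) $v(X-a_\nu)=\gamma_\nu$; (iii) $(a_\nu,\gamma_\nu)$ is a minimal pair of definition for $v_{a_\nu,\gamma_\nu}$ over $K$; (iv) $v(X-a_\nu)\geq v(X-\sigma a_\nu)$ for all $K$-conjugates $\sigma a_\nu$ of $a_\nu$. For each $\nu<\lambda$, take $b_\nu\in\overline{K}$ such that $K(b_\nu)=K(a_\nu)\cap K^r$. Then $$K(b_\nu\mid\nu<\lambda)^h\subseteq IC(K(X)|K,v)\subseteq K(a_\nu\mid\nu<\lambda)^h.$$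
   Context: Valuations are Krull valuations written additively (arbitrary ordered abelian value groups, arbitrary rank). $K$ is a field, $\overline{K}$ a fixed algebraic closure of $K$, $X$ an indeterminate, and $v$ a valuation on $\overline{K}(X)$; its restrictions to subfields are also denoted $v$. For a subfield $F$, $vF$ is the value group and $Fv$ the residue field. The extension $(K(X)|K,v)$ always satisfies $\dim_{\mathbb{Q}}\left(\mathbb{Q}\otimes_{\mathbb{Z}}(vK(X)/vK)\right)+\mathrm{trdeg}[K(X)v:Kv]\leq 1$. It is called valuation algebraic if this inequality is strict (i.e. $vK(X)/vK$ is torsion and $K(X)v|Kv$ is algebraic), and valuation transcendental otherwise. (For valuation algebraic extensions, sequences with properties (i)-(iv) exist.) For $a\in\overline{K}$ and $\gamma$ in an ordered abelian group containing $v\overline{K}$, $v_{a,\gamma}$ is the valuation on $\overline{K}(X)$ extending $v|_{\overline{K}}$ given on polynomials by $v_{a,\gamma}\left(\sum_{i=0}^n c_i(X-a)^i\right)=\min_i\{vc_i+i\gamma\}$, $c_i\in\overline{K}$. A pair of definition over $K$ for a valuation $w$ on $\overline{K}(X)$ extending $v|_{\overline{K}}$ is a pair $(a,\gamma)\in\overline{K}\times w\overline{K}(X)$ with $w=v_{a,\gamma}$. It is a minimal pair of definition for $w$ over $K$ if moreover, for all $a'\in\overline{K}$, $v(a-a')\geq\gamma$ implies $[K(a'):K]\geq[K(a):K]$. Let $K^{\mathrm{sep}}$ be the separable-algebraic closure of $K$ in $\overline{K}$. The absolute ramification field $K^r$ of $(K,v)$ is the fixed field in $K^{\mathrm{sep}}$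 of the group $G^r=\{\sigma\in\mathrm{Gal}(\overline{K}|K)\mid v(\sigma a-a)>va\text{ for all }a\in K^{\mathrm{sep}}\setminus\{0\}\}$. For a subfield $F$ of $\overline{K(X)}$, $F^h$ denotes the henselization of $(F,v)$ taken inside $\overline{K(X)}$ with respect to the fixed extension of $v$. The implicit constant field is $IC(K(X)|K,v):=\overline{K}\cap K(X)^h$. *)

(* Defs.v *)
From HB Require Import structures.
From mathcomp Require Import all_boot all_order all_algebra.
From mathcomp Require Import separable boolp classical_sets.

Set Implicit Arguments.
Unset Strict Implicit.
Unset Printing Implicit Defensive.
Import Order.TTheory GRing.Theory Num.Theory.
Local Open Scope classical_set_scope.
Local Open Scope ring_scope.

(* Totally ordered abelian groups, of arbitrary rank. *)
Record oagType := OagType {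
  oag_sort :> porderZmodType;
  oag_le_total : total (<=%O : rel oag_sort);
  oag_lerD2l : forall x y z : oag_sort, x <= y -> z + x <= z + y }.

(* The totally ordered monoid obtained from the ordered group G by adding an
   absorbing largest element. *)
Variant ext (G : Type) := Fin of G | Inf.
Arguments Inf {G}.

Definition option_of_ext G (x : ext G) := if x is Fin a then Some a else None.
Definition ext_of_option G (x : option G) := if x is Some a then Fin a else Inf.
Lemma option_of_extK G : cancel (@option_of_ext G) (@ext_of_option G).
Proof. by case. Qed.

HB.instance Definition _ (G : choiceType) :=
  Choice.copy (ext G) (can_type (@option_of_extK G)).

Section ExtTheory.
Variable G : porderZmodType.
Implicit Types x y z : ext G.

Definition ext_add x y :=
  if x is Fin a then if y is Fin b then Fin (a + b) else Inf else Inf.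

Definition ext_sub x y :=
  if x is Fin a then if y is Fin b then Fin (a - b) else Inf else Inf.

Definition ext_le x y :=
  if y is Fin b then if x is Fin a then a <= b else false else true.

Definition ext_lt x y := (y != x) && ext_le x y.

Lemma ext_addA : associative ext_add.
Proof. by case=> [a|] [b|] [c|] //=; rewrite addrA. Qed.

Lemma ext_addC : commutative ext_add.
Proof. by case=> [a|] [b|] //=; rewrite addrC. Qed.

Lemma ext_add0 : left_id (Fin 0) ext_add.
Proof. by case=> [a|] //=; rewrite add0r. Qed.

Lemma ext_le_anti : antisymmetric ext_le.
Proof.
by case=> [a|] [b|] //= /andP[ab ba]; rewrite (@le_anti _ _ a b) ?ab.
Qed.

Lemma ext_le_trans : transitive ext_le.
Proof. by case=> [b|] [a|] [c|] //=; exact: le_trans. Qed.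

Lemma ext_le_refl : reflexive ext_le.
Proof. by case=> [a|] //=. Qed.

HB.instance Definition _ :=
  GRing.isNmodule.Build (ext G) ext_addA ext_addC ext_add0.

HB.instance Definition _ := Order.isPOrder.Build ring_display (ext G)
  (fun _ _ => erefl) ext_le_refl ext_le_anti ext_le_trans.

End ExtTheory.

Lemma ext_le_total (G : oagType) : total (<=%O : rel (ext G)).
Proof. by case=> [a|] [b|] //; exact: oag_le_total. Qed.

Section Fields.
Variable F : fieldType.
Implicit Types (A B L E : set F) (x y : F).

Definition subfield L :=
  [/\ L 1, (forall x y, L x -> L y -> L (x - y))
    & (forall x y, L x -> L y -> L (x / y))].

Definition field_gen A : set F :=
  \bigcap_(L in [set L | subfield L /\ A `<=` L]) L.

Definition alg_closure_in A : set F :=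
  [set x | exists p : {poly F}, [/\ p != 0, forall i, A p`_i & root p x]].

Section Valuation.
Variable G : oagType.
Implicit Types u : F -> ext G.

Definition valuation_on E u := forall x y, E x -> E y ->
  [/\ (u x == Inf) = (x == 0), u (x * y) = u x + u y
    & Num.min (u x) (u y) <= u (x + y)].

Definition valuation u := valuation_on setT u.

Definition value_group u : set G := [set g | exists x, u x = Fin g].

(* uB/uA is a torsion group. *)
Definition value_quotient_torsion u A B := forall x, B x -> x != 0 ->
  exists n c, [/\ (0 < n)%N, A c, c != 0 & u x *+ n = u c].

(* Bu | Au is algebraic: the residue of every integral x in B is a root of the
   reduction of a polynomial over the valuation ring of A, and this reduction
   is nonzero. *)
Definition residue_algebraic u A B := forall x, B x -> Fin 0 <= u x ->
  exists p : {poly F}, [/\ forall i, A p`_i, forall i, Fin 0 <= u p`_i,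
    exists i, u p`_i = Fin 0 & Fin 0 < u p.[x]].

Definition valuation_algebraic u A B :=
  value_quotient_torsion u A B /\ residue_algebraic u A B.

End Valuation.
End Fields.

(* The two valuations have the same valuation ring on E, that is, they are
   equivalent on E. *)
Definition equiv_on (F : fieldType) (G G' : oagType) (E : set F)
    (u : F -> ext G) (u' : F -> ext G') :=
  forall x, E x -> (Fin 0 <= u x) = (Fin 0 <= u' x).

Section Henselization.
Variables (Omega : closedFieldType) (G : oagType) (w : Omega -> ext G).

(* The restriction of w to L has a unique extension, up to equivalence, to the
   algebraic closure of L. *)
Definition henselian (L : set Omega) :=
  forall (G' : oagType) (u : Omega -> ext G'),
    valuation_on (alg_closure_in L) u -> equiv_on L u w ->
    equiv_on (alg_closure_in L) u w.

(* The smallest henselian subfield of (Omega, w) that contains A. *)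
Definition henselization (A : set Omega) : set Omega :=
  \bigcap_(L in [set L | [/\ subfield L, A `<=` L & henselian L]]) L.

End Henselization.

Section AlgebraicClosure.
Variables (K : fieldType) (Kb : closedFieldType) (iK : {rmorphism K -> Kb}).
Implicit Types (a : Kb) (S L : set Kb).

Definition adjoin S : set Kb := field_gen (range iK `|` S).

Definition is_basis L n (b : 'I_n -> Kb) :=
  (forall x, L x <-> exists c : 'rV[K]_n, x = \sum_k iK (c 0 k) * b k) /\
  (forall c : 'rV[K]_n, \sum_k iK (c 0 k) * b k = 0 -> c = 0).

(* [L : K], with value 0 if L has infinite degree over K. *)
Definition degree L : nat := xget 0%N [set n | exists b, @is_basis L n b].

Definition galK : set {rmorphism Kb -> Kb} :=
  [set s : {rmorphism Kb -> Kb} |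
    bijective s /\ forall x, s (iK x) = iK x].

Definition sep_closure : set Kb :=
  [set a | exists p : {poly K},
    [/\ irreducible_poly p, root (map_poly iK p) a & separable_poly p]].

Variables (G : oagType) (vK : Kb -> ext G).

Definition ramification_group : set {rmorphism Kb -> Kb} :=
  [set s : {rmorphism Kb -> Kb} | galK s /\
    forall a, sep_closure a -> a != 0 -> vK a < vK (s a - a)].

Definition ramification_field : set Kb :=
  [set a | sep_closure a /\
    forall s : {rmorphism Kb -> Kb}, ramification_group s -> s a = a].

End AlgebraicClosure.

Definition ratX (F : fieldType) : {fraction {poly F}} :=
  FracField.tofrac ('X : {poly F}).

Definition ratC (F : fieldType) (c : F) : {fraction {poly F}} :=
  FracField.tofrac (c%:P : {poly F}).

Section RationalFunctions.
Variables (K : fieldType) (Kb : closedFieldType) (iK : {rmorphism K -> Kb}).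

Definition base_field : set {fraction {poly Kb}} := (@ratC Kb) @` range iK.

Definition base_field_X : set {fraction {poly Kb}} :=
  field_gen (base_field `|` [set ratX Kb]).

Variables (G : oagType) (v : {fraction {poly Kb}} -> ext G).

Definition const_val (c : Kb) : ext G := v (ratC c).

(* min_i (v c_i + i g) for p = \sum_i c_i (X - a)^i; composing p with X + a
   yields the c_i as coefficients. *)
Definition poly_mono_val (a : Kb) (g : G) (p : {poly Kb}) : ext G :=
  let q := p \Po ('X + a%:P) in
  \big[Num.min/Inf]_(i < size q) (const_val q`_i + Fin (g *+ i)).

(* The valuation v_{a,g}. Any numerator and denominator give the same value,
   because poly_mono_val turns products into sums. *)
Definition mono_val (a : Kb) (g : G) (f : {fraction {poly Kb}}) : ext G :=
  ext_sub (poly_mono_val a g (frac (repr f)).1)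
          (poly_mono_val a g (frac (repr f)).2).

Definition pair_of_definition (w : {fraction {poly Kb}} -> ext G)
    (a : Kb) (g : G) :=
  value_group w g /\ w =1 mono_val a g.

Definition minimal_pair_of_definition (w : {fraction {poly Kb}} -> ext G)
    (a : Kb) (g : G) :=
  pair_of_definition w a g /\
  forall a' : Kb, Fin g <= const_val (a - a') ->
    (degree iK (adjoin iK [set a]) <= degree iK (adjoin iK [set a']))%N.

(* w is a valuation on an algebraically closed extension Omega of Kb(X), which is
   embedded by j. *)
Definition implicit_constant_field (Omega : closedFieldType)
    (j : {fraction {poly Kb}} -> Omega) (w : Omega -> ext G) : set Omega :=
  range (fun c : Kb => j (ratC c)) `&` henselization w (j @` base_field_X).

End RationalFunctions.

(* The order types of nonzero limit ordinals. *)
Definition limit_ordinal (d : Order.disp_t) (I : orderType d) :=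
  [/\ well_founded (fun x y : I => (x < y)%O), inhabited I
    & forall x : I, exists y : I, (x < y)%O].

(* Main.v *)
(** First inclusion. Let L be a henselian field containing K(X). An automorphism
    tau over L preserves the valuation, so v (a - tau a) >= gamma for a = a_nu,
    gamma = gamma_nu. Since (a, gamma) is a minimal pair, the roots z of a
    polynomial f over K of degree less than [K(a) : K] satisfy v (a - z) < gamma;
    hence f(a) and f(tau a) have the same leading term, and tau acts trivially
    on the leading terms of K(a). Such a tau is a product of an automorphism
    fixing K(a) and of one acting trivially on all leading terms; the latter
    lies in the ramification group, so tau fixes b_nu. As b_nu is separable
    over K, it lies in L.

    Second inclusion. Let M be henselian and contain all a_nu, and let x be an
    element of IC(K(X)|K, v). An automorphism of the algebraic closure of K that
    fixes M preserves all v (X - c), because the values v (X - a_nu) are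
    cofinal. By the conjugacy of valuations it extends to an automorphism over
    K(X) preserving the valuation, and thus fixes x. So x is purely inseparable
    over M. If x were not in M, we could assume that x^p is in M, and a maximal
    extension of K(X) containing x^p but not x would be henselian, because the
    algebraic closure is purely inseparable over it. *)
From HB Require Import structures.
Require Import Defs.
From mathcomp Require Import all_boot all_order all_algebra.
From mathcomp Require Import generic_quotient separable.
From mathcomp Require Import boolp classical_sets filter zify ring.

Set Implicit Arguments.
Unset Strict Implicit.
Unset Printing Implicit Defensive.
Import Order.TTheory GRing.Theory.
Local Open Scope classical_set_scope.
Local Open Scope ring_scope.

(** * Ordered groups with infinity, valuations and leading terms *)

(** The hard point is the factorisation of tau. For E = K(a), an automorphism g over E is sought
    such that g x and tau x have the same leading term. The orbit polynomial of x under the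
    isometries over E provides one: if tau fixes the leading terms of its coefficients, then tau x
    is close to one of its roots. These coefficients lie in the decomposition field of E rather than
    in E, so the triviality of tau on leading terms has to be transferred to that field; this works
    because its leading terms are, up to purely inseparable powers, those of E. One g must also
    serve all x at once: finitely many elements are merged into a single polynomial, and compactness
    of the automorphism group does the rest.

    Elements fixed by all automorphisms are known to lie in the base field only after raising to a
    power of the characteristic exponent, which is why such powers recur. Henselizations are
    intersections, so an upper bound for one needs a single henselian field, chosen as a
    decomposition field, a maximal field avoiding an element, or the field of all constants. *)

HB.instance Definition _ (G : oagType) :=
  Order.POrder_isTotal.Build ring_display (ext G) (@ext_le_total G).

Section Ext.
Variable G : oagType.
Implicit Types (x y z t : ext G) (g h : G).

Lemma Fin_inj : injective (@Fin G). Proof. by move=> g h []. Qed.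

Lemma lt_Fin g h : (Fin g < Fin h) = (g < h).
Proof. by rewrite !lt_neqAle (inj_eq Fin_inj). Qed.

Lemma le_Inf x : x <= Inf. Proof. by []. Qed.

Lemma lt_Inf x : (x < Inf) = (x != Inf).
Proof. by rewrite lt_neqAle le_Inf andbT. Qed.

Lemma Inf_le x : (Inf <= x) = (x == Inf).
Proof. by rewrite eq_le le_Inf. Qed.

Lemma lt_neqInf x y : x < y -> x != Inf.
Proof. by move=> xy; rewrite -lt_Inf (lt_le_trans xy). Qed.

Lemma neqInfP x : x != Inf -> exists g, x = Fin g.
Proof. by case: x => [g|//] _; exists g. Qed.

Lemma addInf x : Inf + x = Inf. Proof. by []. Qed.

Lemma addxInf x : x + Inf = Inf. Proof. by case: x. Qed.

Lemma add_eqInf x y : (x + y == Inf) = (x == Inf) || (y == Inf).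
Proof. by case: x => [g|]; case: y => [h|]. Qed.

Lemma FinD g h : Fin (g + h) = Fin g + Fin h. Proof. by []. Qed.

Lemma FinMn g n : Fin (g *+ n) = Fin g *+ n.
Proof. by elim: n => [//|n IH]; rewrite !mulrS FinD IH. Qed.

Lemma ext_leD2r z x y : x <= y -> x + z <= y + z.
Proof.
case: z => [g|]; last by rewrite !addxInf.
case: y => [h|] //; case: x => [k|] // kh.
by rewrite ![_ + Fin g]addrC; exact: (oag_lerD2l g kh).
Qed.

Lemma ext_leD x y z t : x <= y -> z <= t -> x + z <= y + t.
Proof.
move=> xy zt; apply: le_trans (ext_leD2r _ xy) _.
by rewrite addrC [y + t]addrC ext_leD2r.
Qed.

Lemma ext_addIr z : z != Inf -> injective (+%R ^~ z).
Proof.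
case: z => [g|//] _ [a|] [b|] //= /Fin_inj /addIr ->.
by [].
Qed.

Lemma ext_ltD2r z x y : z != Inf -> (x + z < y + z) = (x < y).
Proof.
move=> zI; apply/idP/idP; last first.
  rewrite !lt_neqAle => /andP[xy /ext_leD2r ->]; rewrite andbT.
  by apply: contraNN xy => /eqP/(ext_addIr zI) ->.
by apply: contraTT; rewrite -!leNgt => /ext_leD2r ->.
Qed.

Lemma ext_leD2 z x y : z != Inf -> (x + z <= y + z) = (x <= y).
Proof. by move=> zI; rewrite !leNgt ext_ltD2r. Qed.

Lemma ext_lt_leD x y z t : z != Inf -> x < y -> z <= t -> x + z < y + t.
Proof.
move=> zI xy zt; apply: (@lt_le_trans _ _ (y + z)); first by rewrite ext_ltD2r.
by rewrite addrC [y + t]addrC ext_leD2r.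
Qed.

Lemma ext_addr_ge0 x y : Fin 0 <= x -> Fin 0 <= y -> Fin 0 <= x + y.
Proof. by move=> x0 y0; rewrite -[Fin 0]addr0 ext_leD. Qed.

Lemma ext_addr_gt0 x y : Fin 0 < x -> Fin 0 <= y -> Fin 0 < x + y.
Proof. by move=> x0 y0; rewrite -[Fin 0]addr0 ext_lt_leD. Qed.

Lemma ext_lt_addl z x : z != Inf -> Fin 0 < x -> z < x + z.
Proof.
move=> zI x0; have := ext_ltD2r (Fin 0) x zI.
by rewrite x0 -[Fin 0 + z]/(0 + z) add0r.
Qed.

Lemma ext_muln_eqInf x n : (0 < n)%N -> (x *+ n == Inf) = (x == Inf).
Proof.
elim: n => [//|[|n] IH] _; first by rewrite mulr1n.
by rewrite mulrS add_eqInf IH // orbb.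
Qed.

Lemma ext_ltMn n x y : (0 < n)%N -> x < y -> x *+ n < y *+ n.
Proof.
elim: n => [//|[|n] IH] _ xy; first by rewrite !mulr1n.
rewrite !(mulrS _ n.+1) ext_lt_leD ?IH //; last exact/ltW/IH.
by rewrite ext_muln_eqInf // (lt_neqInf xy).
Qed.

Lemma ext_leMn n x y : x <= y -> x *+ n <= y *+ n.
Proof. by move=> xy; elim: n => [//|n IH]; rewrite !mulrS ext_leD. Qed.

Lemma ext_leMn2r n x y : (0 < n)%N -> (x *+ n <= y *+ n) = (x <= y).
Proof.
move=> n0; apply/idP/idP; last exact: ext_leMn.
by apply: contraTT; rewrite -!ltNge; exact: ext_ltMn.
Qed.

Lemma ext_ltMn2r n x y : (0 < n)%N -> (x *+ n < y *+ n) = (x < y).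
Proof. by move=> n0; rewrite !ltNge ext_leMn2r. Qed.

Lemma ext_ge0Mn n x : (0 < n)%N -> (Fin 0 <= x *+ n) = (Fin 0 <= x).
Proof. by move=> n0; rewrite -(ext_leMn2r (Fin 0) x n0) -FinMn mul0rn. Qed.

Lemma ext_eqMn n x y : (0 < n)%N -> x *+ n = y *+ n -> x = y.
Proof.
by move=> n0 e; apply/le_anti; rewrite -(ext_leMn2r x y n0) -(ext_leMn2r y x n0) e lexx.
Qed.

End Ext.

(* Domains rather than fields, to allow Gauss valuations on polynomial rings. *)
Definition dval (R : idomainType) (G : oagType) (W : R -> ext G) :=
  [/\ forall x, (W x == Inf) = (x == 0),
      forall x y, W (x * y) = W x + W y
    & forall x y, Num.min (W x) (W y) <= W (x + y)].

Lemma valuationP (F : fieldType) (G : oagType) (u : F -> ext G) :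
  valuation u <-> dval u.
Proof.
split=> [uv|[u0 uM uD] x y _ _]; last by split.
split=> [x|x y|x y].
- by have [] := uv x x I I.
- by have [] := uv x y I I.
- by have [] := uv x y I I.
Qed.

Section DVal.
Variables (R : idomainType) (G : oagType) (W : R -> ext G).
Hypothesis dW : dval W.

Lemma dval_eqInf x : (W x == Inf) = (x == 0). Proof. by case: dW. Qed.
Lemma dvalM x y : W (x * y) = W x + W y. Proof. by case: dW. Qed.
Lemma dval0 : W 0 = Inf. Proof. by apply/eqP; rewrite dval_eqInf. Qed.

Lemma dval_neqInf x : x != 0 -> W x != Inf. Proof. by rewrite dval_eqInf. Qed.

Lemma dval1 : W 1 = Fin 0.
Proof.
apply: (@ext_addIr _ (W 1)); first by rewrite dval_neqInf ?oner_eq0.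
by rewrite /= -dvalM mulr1 -[RHS]/(0 + W 1) add0r.
Qed.

Lemma dvalX x n : W (x ^+ n) = W x *+ n.
Proof. by elim: n => [|n IH]; rewrite ?expr0 ?dval1 // exprS dvalM IH mulrS. Qed.

Lemma dvalN x : W (- x) = W x.
Proof.
apply: (@ext_eqMn _ 2) => //; rewrite -!dvalX sqrrN //.
Qed.

Lemma dval_leD g x y : g <= W x -> g <= W y -> g <= W (x + y).
Proof. by move=> gx gy; case: dW => _ _ /(_ x y); apply: le_trans; rewrite le_min gx. Qed.

Lemma dval_leB g x y : g <= W x -> g <= W y -> g <= W (x - y).
Proof. by move=> gx gy; rewrite dval_leD ?dvalN. Qed.

Lemma dval_ltD g x y : g < W x -> g < W y -> g < W (x + y).
Proof. by move=> gx gy; case: dW => _ _ /(_ x y); apply: lt_le_trans; rewrite lt_min gx. Qed.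

Lemma dval_ltB g x y : g < W x -> g < W y -> g < W (x - y).
Proof. by move=> gx gy; rewrite dval_ltD ?dvalN. Qed.

Lemma dval_sum_lt g (I : Type) (r : seq I) (P : pred I) (E : I -> R) :
  g != Inf -> (forall i, P i -> g < W (E i)) -> g < W (\sum_(i <- r | P i) E i).
Proof.
move=> gI ge; elim/big_rec: _ => [|i x Pi gx]; first by rewrite dval0 lt_Inf.
by rewrite dval_ltD ?ge.
Qed.

Lemma dval_eqD x y : W x < W y -> W (x + y) = W x.
Proof.
move=> xy; apply/le_anti/andP; split; last by rewrite dval_leD // ltW.
rewrite leNgt; apply/negP => lt.
by have := dval_ltB lt xy; rewrite addrK ltxx.
Qed.

(** Equality of leading terms, that is, of classes modulo the one-units when R is a field. Since W 0
    is the largest value, it forces x and y to be nonzero. *)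
Definition sim x y := W x < W (x - y).

Lemma sim_neq0 x y : sim x y -> x != 0.
Proof. by move=> /lt_neqInf; rewrite dval_eqInf. Qed.

Lemma sim_val x y : sim x y -> W y = W x.
Proof.
move=> xy; rewrite -[y](addrNK x) addrC dval_eqD // -opprB dvalN //.
Qed.

Lemma sim_refl x : x != 0 -> sim x x.
Proof. by move=> x0; rewrite /sim subrr dval0 lt_Inf dval_neqInf. Qed.

Lemma sim_sym x y : sim x y -> sim y x.
Proof. by move=> xy; rewrite /sim (sim_val xy) -opprB dvalN. Qed.

Lemma sim_trans x y z : sim x y -> sim y z -> sim x z.
Proof.
move=> xy yz; rewrite /sim -(subrKA y) dval_ltD //.
by rewrite -(sim_val xy).
Qed.

Lemma simM x y z t : sim x y -> sim z t -> sim (x * z) (y * t).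
Proof.
move=> xy zt; apply: (@sim_trans _ (y * z)).
  rewrite /sim -mulrBl !dvalM ext_ltD2r //.
  exact/dval_neqInf/(sim_neq0 zt).
rewrite /sim -mulrBr !dvalM ![W y + _]addrC ext_ltD2r //.
exact/dval_neqInf/(sim_neq0 (sim_sym xy)).
Qed.

Lemma sim_exp n x y : sim x y -> sim (x ^+ n) (y ^+ n).
Proof.
move=> xy; elim: n => [|n IH]; first by rewrite sim_refl ?oner_eq0.
by rewrite !exprS simM.
Qed.

(** Here x^q - y^q = (x - y)^q has q times the value of x - y. This recovers leading terms from
    purely inseparable powers. *)
Lemma sim_pchar_exp q x y : [pchar R].-nat q -> sim (x ^+ q) (y ^+ q) -> sim x y.
Proof.
move=> qp; rewrite /sim -(exprNn_pchar y qp) -exprDn_pchar // !dvalX ext_ltMn2r //.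
by case/andP: qp.
Qed.

End DVal.

(** * Polynomials over a subfield *)

Definition polyIn (F : fieldType) (A : set F) (p : {poly F}) := forall i, A p`_i.

Section Subfield.
Variables (Om : fieldType) (F : set Om).
Hypothesis sF : subfield F.
Implicit Types (x y : Om) (p q g h : {poly Om}).

Lemma sf1 : F 1. Proof. by case: sF. Qed.
Lemma sfB x y : F x -> F y -> F (x - y). Proof. by case: sF => _ + _; apply. Qed.
Lemma sf_div x y : F x -> F y -> F (x / y). Proof. by case: sF => _ _; apply. Qed.
Lemma sf0 : F 0. Proof. by rewrite -(subrr 1); apply: sfB; exact: sf1. Qed.
Lemma sfN x : F x -> F (- x).
Proof. by move=> Fx; rewrite -sub0r; apply: sfB => //; exact: sf0. Qed.
Lemma sfD x y : F x -> F y -> F (x + y).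
Proof. by move=> Fx Fy; rewrite -[y]opprK; apply: sfB => //; exact: sfN. Qed.
Lemma sfV x : F x -> F x^-1.
Proof. by move=> Fx; rewrite -div1r; apply: sf_div => //; exact: sf1. Qed.
Lemma sfM x y : F x -> F y -> F (x * y).
Proof. by move=> Fx Fy; rewrite -[y]invrK; apply: sf_div => //; exact: sfV. Qed.
Lemma sfX x n : F x -> F (x ^+ n).
Proof.
by move=> Fx; elim: n => [|n IH]; rewrite ?expr0 ?exprS; [exact: sf1|exact: sfM].
Qed.
Lemma sf_sum (I : Type) (r : seq I) (P : pred I) (E : I -> Om) :
  (forall i, P i -> F (E i)) -> F (\sum_(i <- r | P i) E i).
Proof. by move=> FE; elim/big_rec: _ => [|i x /FE]; [exact: sf0|exact: sfD]. Qed.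
Lemma sf_prod (I : Type) (r : seq I) (P : pred I) (E : I -> Om) :
  (forall i, P i -> F (E i)) -> F (\prod_(i <- r | P i) E i).
Proof. by move=> FE; elim/big_rec: _ => [|i x /FE]; [exact: sf1|exact: sfM]. Qed.

Lemma polyInB p q : polyIn F p -> polyIn F q -> polyIn F (p - q).
Proof. by move=> Fp Fq i; rewrite coefB; apply: sfB. Qed.
Lemma polyInD p q : polyIn F p -> polyIn F q -> polyIn F (p + q).
Proof. by move=> Fp Fq i; rewrite coefD; apply: sfD. Qed.
Lemma polyInM p q : polyIn F p -> polyIn F q -> polyIn F (p * q).
Proof. by move=> Fp Fq i; rewrite coefM; apply: sf_sum => j _; apply: sfM. Qed.
Lemma polyInC x : F x -> polyIn F x%:P.
Proof. by move=> Fx i; rewrite coefC; case: eqP => // _; exact: sf0. Qed.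
Lemma polyIn0 : polyIn F 0. Proof. by move=> i; rewrite coef0; exact: sf0. Qed.
Lemma polyInXn n : polyIn F 'X^n.
Proof. by move=> i; rewrite coefXn; case: eqP => _; [exact: sf1|exact: sf0]. Qed.
Lemma polyInX : polyIn F 'X. Proof. exact: (polyInXn 1). Qed.
Lemma polyInZ x p : F x -> polyIn F p -> polyIn F (x *: p).
Proof. by move=> Fx Fp i; rewrite coefZ; apply: sfM. Qed.
Lemma polyIn_edivp d p : polyIn F d -> d != 0 -> polyIn F p ->
  exists q r, [/\ polyIn F q, polyIn F r, p = q * d + r & (size r < size d)%N].
Proof.
move=> Fd d0; elim: (size p).+1 {-2}p (ltnSn (size p)) => // {p}n IH p sp Fp.
have [lt|le] := ltnP (size p) (size d).
  exists 0, p; split => //; first exact: polyIn0.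
  by rewrite mul0r add0r.
pose c := lead_coef p / lead_coef d; pose k := (size p - size d)%N.
pose p1 := p - c *: 'X^k * d.
have Fq : polyIn F (c *: 'X^k).
  by apply: polyInZ; [apply: sf_div; [exact: Fp|exact: Fd]|exact: polyInXn].
have Fp1 : polyIn F p1 by apply: polyInB => //; apply: polyInM.
have szd : (0 < size d)%N by rewrite size_poly_gt0.
have szp : (0 < size p)%N by apply: leq_trans le.
have s1 : (size p1 < size p)%N.
  rewrite -(prednK szp) ltnS; apply/leq_sizeP => j lej.
  rewrite coefB -scalerAl coefZ coefXnM.
  have -> : (j < k)%N = false by apply/negbTE; rewrite /k; lia.
  move: lej; rewrite leq_eqVlt => /orP[/eqP <-|lt].
    have -> : ((size p).-1 - k = (size d).-1)%N by rewrite /k; lia.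
    by rewrite -!lead_coefE /c divfK ?subrr // lead_coef_eq0.
  have e1 : (size p <= j)%N by lia.
  have e2 : (size d <= j - k)%N by rewrite /k; lia.
  by rewrite (nth_default 0 e1) (nth_default 0 e2) mulr0 subr0.
have [q [r [Fq' Fr e sr]]] := IH p1 (leq_trans s1 sp) Fp1.
exists (q + c *: 'X^k), r; split=> //; first exact: polyInD.
by rewrite mulrDl addrAC -e subrK.
Qed.

(** The cofactor k is required to be over F, so that a homomorphism defined on F alone can be
    applied to the factorisation. *)
Definition minpoly x g := [/\ g \is monic, polyIn F g, root g x
  & forall h, polyIn F h -> root h x -> exists2 k, polyIn F k & h = k * g].

Lemma minpoly_ex x : alg_closure_in F x -> exists g, minpoly x g.
Proof.
move=> [p [p0 Fp px]].
pose P n := `[< exists h, [/\ h != 0, polyIn F h, root h x & size h = n] >].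
have [n /asboolP[h [h0 Fh hx sh]] minn] :
    exists2 n, P n & forall m, P m -> (n <= m)%N.
  have exP : exists n, P n by exists (size p); apply/asboolP; exists p.
  by exists (ex_minn exP); case: ex_minnP.
pose g := (lead_coef h)^-1 *: h.
have lh : (lead_coef h)^-1 != 0 by rewrite invr_eq0 lead_coef_eq0.
have g0 : g != 0 by rewrite scaler_eq0 negb_or lh.
have Fg : polyIn F g by apply: polyInZ => //; apply: sfV; exact: Fh.
exists g; split=> //.
- by rewrite monicE lead_coefZ mulVf // lead_coef_eq0.
- by rewrite rootZ.
move=> f Ff fx; have [q [r [Fq Fr e sr]]] := polyIn_edivp Fg g0 Ff.
exists q => //; rewrite e.
have -> : r = 0; last by rewrite addr0.
apply/eqP; apply: contraTT sr => r0; rewrite -leqNgt.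
rewrite size_scale // sh; apply: minn; apply/asboolP; exists r; split=> //.
have : root (f - q * g) x.
  by rewrite /root hornerD hornerN hornerM (rootP fx) hornerZ (rootP hx) !mulr0 subrr.
by rewrite e addrC addKr.
Qed.

Lemma minpoly_size x g : minpoly x g -> (1 < size g)%N.
Proof.
case=> mg _ gx _; rewrite ltnNge; apply/negP => /size1_polyC e.
move: mg gx; rewrite e monicE lead_coefC /root hornerC => /eqP ->.
by rewrite oner_eq0.
Qed.

Lemma minpoly_small x g h :
  minpoly x g -> polyIn F h -> root h x -> (size h < size g)%N -> h = 0.
Proof.
move=> [mg _ _ mi] Fh hx; have [k _ ->] := mi h Fh hx.
have [->|k0] := eqVneq k 0; first by rewrite mul0r.
rewrite size_Mmonic // => lt; exfalso; move: lt.
by rewrite -(prednK (_ : 0 < size k)%N) ?size_poly_gt0 //= ltnNge leq_addl.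
Qed.

Lemma minpoly_rem x g h : minpoly x g -> polyIn F h ->
  exists2 r, polyIn F r & (size r < size g)%N /\ r.[x] = h.[x].
Proof.
move=> [mg Fg gx _] Fh; have [q [r [_ Fr -> sr]]] := polyIn_edivp Fg (monic_neq0 mg) Fh.
by exists r => //; rewrite hornerD hornerM (rootP gx) mulr0 add0r.
Qed.

(** Dividing g by h gives [r.[x] = - (q.[x] * h.[x])] with r smaller than h, so an inverse of
    [r.[x]] yields one of [h.[x]]. If [r.[x]] is 0 and h is not constant, then g = q * h, and q is a
    polynomial smaller than g that vanishes at x, which is impossible. *)
Lemma minpoly_inv x g h : minpoly x g -> polyIn F h -> h.[x] != 0 ->
  exists2 k, polyIn F k & h.[x] * k.[x] = 1.
Proof.
move=> mg; have [mo Fg gx _] := mg.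
suff small h' : polyIn F h' -> h'.[x] != 0 -> (size h' < size g)%N ->
    exists2 k, polyIn F k & h'.[x] * k.[x] = 1.
  by move=> Fh hx; have [r Fr [sr rx]] := minpoly_rem mg Fh;
    rewrite -rx; apply: small; rewrite // rx.
elim: (size h').+1 {-2}h' (ltnSn (size h')) => // {h h'}n IH h sh Fh hx shg.
have [h1|h1] := eqVneq (size h) 1%N.
  have e : h = (h`_0)%:P by apply: size1_polyC; rewrite h1.
  exists (h`_0)^-1%:P; first by apply: polyInC; apply: sfV; exact: Fh.
  by move: hx; rewrite e !hornerC coefC eqxx => hx; rewrite mulfV.
have h0 : h != 0 by apply: contraNneq hx => ->; rewrite horner0.
have [q [r [Fq Fr e sr]]] := polyIn_edivp Fh h0 Fg.
have rx : r.[x] = - (q.[x] * h.[x]).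
  apply/eqP; rewrite -addr_eq0 addrC -hornerM -hornerD -e; exact/eqP/rootP.
have [r0|r0] := eqVneq r.[x] 0; last first.
  have [k Fk kx] := IH r (leq_trans sr sh) Fr r0 (ltn_trans sr shg).
  exists (- (q * k)); last by rewrite hornerN hornerM mulrN mulrA (mulrC h.[x]) -mulNr -rx.
  by rewrite -sub0r; apply: polyInB; [exact: polyIn0|exact: polyInM].
have rz : r = 0 by apply: (minpoly_small mg) => //; [exact/rootP|exact: ltn_trans shg].
have qx : root q x.
  by apply/rootP/eqP; move/eqP: rx; rewrite r0 eq_sym oppr_eq0 mulf_eq0 (negbTE hx) orbF.
have q0 : q != 0.
  by apply: contraTneq (monic_neq0 mo) => q0; rewrite e q0 rz mul0r addr0 eqxx.
have := q0; rewrite (minpoly_small mg Fq qx) ?eqxx //.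
move: (e); rewrite rz addr0 => ->; rewrite size_mul //.
by move: h0 h1; rewrite -size_poly_gt0; case: (size h) => [|[|m]] // _ _; rewrite !addnS ltnS leq_addr.
Qed.

End Subfield.

(** * Extension of field homomorphisms *)

Section Extension.
Variable Om : closedFieldType.
Implicit Types (R S : set (Om * Om)) (F : set Om) (h g : {poly Om}).

(* Homomorphisms from subfields of Om to Om are represented by their graphs, so
   that Zorn's lemma applies to unions. *)
Definition hom_graph R := [/\ R (1, 1),
  forall x x' y y', R (x, y) -> R (x', y') -> R (x - x', y - y'),
  forall x x' y y', R (x, y) -> R (x', y') -> R (x / x', y / y')
  & forall y, R (0, y) -> y = 0].

Definition hom_dom R : set Om := [set x | exists y, R (x, y)].

Definition poly_graph R h g := forall i, R (h`_i, g`_i).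

Section HomGraph.
Variable R : set (Om * Om).
Hypothesis hR : hom_graph R.

Lemma hg1 : R (1, 1). Proof. by case: hR. Qed.
Lemma hgB x x' y y' : R (x, y) -> R (x', y') -> R (x - x', y - y').
Proof. by case: hR => _ + _ _; apply. Qed.
Lemma hg_div x x' y y' : R (x, y) -> R (x', y') -> R (x / x', y / y').
Proof. by case: hR => _ _ + _; apply. Qed.
Lemma hg00 : R (0, 0).
Proof. by rewrite -(subrr 1); apply: hgB; exact: hg1. Qed.
Lemma hgN x y : R (x, y) -> R (- x, - y).
Proof. by move=> xy; rewrite -[- x]sub0r -[- y]sub0r; apply: hgB => //; exact: hg00. Qed.
Lemma hgD x x' y y' : R (x, y) -> R (x', y') -> R (x + x', y + y').
Proof. by move=> a b; rewrite -[x']opprK -[y']opprK; apply: hgB => //; exact: hgN. Qed.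
Lemma hgM x x' y y' : R (x, y) -> R (x', y') -> R (x * x', y * y').
Proof.
move=> a b; rewrite -[x']invrK -[y']invrK -[x'^-1]div1r -[y'^-1]div1r.
by apply: hg_div => //; apply: hg_div => //; exact: hg1.
Qed.
Lemma hg_fun x y y' : R (x, y) -> R (x, y') -> y = y'.
Proof.
move=> a b; apply/eqP; rewrite -subr_eq0; apply/eqP.
by case: hR => _ _ _; apply; rewrite -(subrr x); apply: hgB.
Qed.
Lemma hg_dom : subfield (hom_dom R).
Proof.
split; first by exists 1; exact: hg1.
- by move=> x y [x' a] [y' b]; exists (x' - y'); apply: hgB.
- by move=> x y [x' a] [y' b]; exists (x' / y'); apply: hg_div.
Qed.
Lemma hg_sum (I : Type) (r : seq I) (E E' : I -> Om) :
  (forall i, R (E i, E' i)) -> R (\sum_(i <- r) E i, \sum_(i <- r) E' i).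
Proof.
move=> RE; elim: r => [|i r IH]; first by rewrite !big_nil; exact: hg00.
by rewrite !big_cons; apply: hgD.
Qed.

Lemma poly_graph_ex h : polyIn (hom_dom R) h -> exists g, poly_graph R h g.
Proof.
move=> /choice[f Rf]; exists (\poly_(i < size h) f i) => i.
rewrite coef_poly; case: ltnP => // le; rewrite nth_default //; exact: hg00.
Qed.
Lemma poly_graphB h h' g g' : poly_graph R h g -> poly_graph R h' g' ->
  poly_graph R (h - h') (g - g').
Proof. by move=> a b i; rewrite !coefB; apply: hgB. Qed.
Lemma poly_graphM h h' g g' : poly_graph R h g -> poly_graph R h' g' ->
  poly_graph R (h * h') (g * g').
Proof. by move=> a b i; rewrite !coefM; apply: hg_sum => j; apply: hgM. Qed.
Lemma poly_graphC x y : R (x, y) -> poly_graph R x%:P y%:P.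
Proof. by move=> a i; rewrite !coefC; case: eqP => // _; exact: hg00. Qed.
Lemma poly_graphX : poly_graph R 'X 'X.
Proof. by move=> i; rewrite !coefX; case: eqP => _; [exact: hg1|exact: hg00]. Qed.
Lemma poly_graph_fun h g g' : poly_graph R h g -> poly_graph R h g' -> g = g'.
Proof. by move=> a b; apply/polyP => i; apply: hg_fun. Qed.
Lemma poly_graph_in h g : poly_graph R h g -> polyIn (hom_dom R) h.
Proof. by move=> a i; exists g`_i. Qed.
Lemma poly_graph_size h g : h \is monic -> poly_graph R h g -> size g = size h.
Proof.
move=> mh a; apply/eqP; rewrite eqn_leq; apply/andP; split.
  apply/leq_sizeP => j /leq_sizeP hj; have := a j; rewrite hj // => b.
  exact: (hg_fun b hg00).
have h0 : (0 < size h)%N by rewrite size_poly_gt0 monic_neq0.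
rewrite -(prednK h0) ltnNge; apply/negP => /leq_sizeP/(_ _ (leqnn _)) e.
have := a (size h).-1; rewrite e -lead_coefE (monicP mh) => b.
by have /eqP := hg_fun hg1 b; rewrite oner_eq0.
Qed.

Section Step.
Variables (c c' : Om) (g g' : {poly Om}).
Hypotheses (mg : minpoly (hom_dom R) c g) (gg' : poly_graph R g g').
Hypothesis (gc' : root g' c').

Definition ext_graph : set (Om * Om) :=
  [set xy | exists h h', [/\ poly_graph R h h', xy.1 = h.[c] & xy.2 = h'.[c']]].

(** Well-definedness of the map sending c to c': h is a multiple of g, so its image h' is a multiple
    of g', which vanishes at c'. *)
Lemma ext_graph0 h h' : poly_graph R h h' -> h.[c] = 0 -> h'.[c'] = 0.
Proof.
move=> hh' hc; have [_ _ _ mi] := mg.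
have [k Fk e] := mi _ (poly_graph_in hh') (introT rootP hc).
have [k' kk'] := poly_graph_ex Fk.
have -> : h' = k' * g'.
  by apply: poly_graph_fun hh' _; rewrite e; exact: poly_graphM.
by rewrite hornerM (rootP gc') mulr0.
Qed.

Lemma ext_graphP : hom_graph ext_graph.
Proof.
split.
- by exists 1, 1; rewrite !hornerC; split => //; apply: poly_graphC; exact: hg1.
- move=> _ _ _ _ [h [k [/= a -> ->]]] [h' [k' [/= b -> ->]]].
  by exists (h - h'), (k - k'); rewrite /= !hornerD !hornerN; split=> //; exact: poly_graphB.
- move=> _ _ _ _ [h [k [/= a -> ->]]] [h' [k' [/= b -> ->]]].
  have [z|nz] := eqVneq h'.[c] 0.
    exists 0, 0; rewrite /= !horner0 z (ext_graph0 b z) !invr0 !mulr0; split=> //.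
    by apply: poly_graphC; exact: hg00.
  have [l Fl e] := minpoly_inv hg_dom mg (poly_graph_in b) nz.
  have [l' ll'] := poly_graph_ex Fl.
  have e' : k'.[c'] * l'.[c'] = 1.
    have bl : poly_graph R (h' * l - 1) (k' * l' - 1).
      by apply: poly_graphB (poly_graphM b ll') _; apply: poly_graphC; exact: hg1.
    apply/eqP; rewrite -subr_eq0; apply/eqP.
    have := ext_graph0 bl; rewrite !hornerD !hornerN !hornerM !hornerC e.
    by rewrite subrr => ->.
  exists (h * l), (k * l'); rewrite /= !hornerM; split; first exact: poly_graphM.
    by congr (_ * _); apply: (mulfI nz); rewrite e mulfV.
  have nz' : k'.[c'] != 0.
    by apply: contra_eq_neq e' => ->; rewrite mul0r eq_sym oner_eq0.
  by congr (_ * _); apply: (mulfI nz'); rewrite e' mulfV.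
- by move=> y [h [k [/= a /esym e ->]]]; exact: ext_graph0 a e.
Qed.

Lemma ext_graph_sub : R `<=` ext_graph.
Proof.
move=> [x y] a; exists x%:P, y%:P; rewrite /= !hornerC; split=> //.
exact: poly_graphC.
Qed.

Lemma ext_graph_pt : ext_graph (c, c').
Proof. by exists 'X, 'X; rewrite /= !hornerX; split=> //; exact: poly_graphX. Qed.

End Step.

End HomGraph.

Lemma alg_closureS F F' : F `<=` F' -> alg_closure_in F `<=` alg_closure_in F'.
Proof. by move=> FF x [p [p0 Fp px]]; exists p; split=> // i; apply: FF. Qed.

(** If S is maximal, an algebraic element c outside its domain could still be sent to a root of the
    transported minimal polynomial, which has the same size as the original and hence is not
    constant. *)
Theorem hom_graph_extend R : hom_graph R ->
  exists S, [/\ hom_graph S, R `<=` S & alg_closure_in (hom_dom R) `<=` hom_dom S].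
Proof.
move=> hR; pose P S := S = set0 \/ hom_graph S /\ R `<=` S.
have [S [PS maxS]] : exists S, P S /\ forall T, S `<` T -> ~ P T.
  apply: Zorn_bigcup => C CP tot.
  have [[S0 CS0 [hS0 RS0]]|no] :=
      pselect (exists2 S0, C S0 & hom_graph S0 /\ R `<=` S0); last first.
    left; apply/seteqP; split => // xy [S CS Sxy].
    have [S0|h] := CP S CS; first by rewrite S0 in Sxy.
    by exfalso; apply: no; exists S.
  right; split; last by move=> xy Rxy; exists S0 => //; exact: RS0.
  have two xy xy' : (\bigcup_(X in C) X) xy -> (\bigcup_(X in C) X) xy' ->
      exists T, [/\ C T, hom_graph T, T xy & T xy'].
    move=> [T CT Txy] [T' CT' Txy'].
    have hgT U (zt : Om * Om) : C U -> U zt -> hom_graph U.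
      by move=> CU Uzt; have [U0|[]//] := CP U CU; rewrite U0 in Uzt.
    have [TT|TT] := tot T T' CT CT'.
      by exists T'; split=> //; [exact: hgT Txy'|exact: TT].
    by exists T; split=> //; [exact: hgT Txy|exact: TT].
  split.
  - by exists S0 => //; exact: hg1.
  - move=> x x' y y' a b; have [T [CT hT Ta Tb]] := two _ _ a b.
    by exists T => //; exact: hgB.
  - move=> x x' y y' a b; have [T [CT hT Ta Tb]] := two _ _ a b.
    by exists T => //; exact: hg_div.
  - by move=> y a; have [T [CT [_ _ _ hT] Ta _]] := two _ _ a a; apply: hT.
have nR : R !=set0 by exists (1, 1); exact: hg1.
have [S0|[hS RS]] := PS.
  exfalso; apply: (maxS R); last by right; split.
  rewrite S0; split => // [R0]; case: nR => z Rz.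
  exact: (R0 z Rz).
exists S; split=> // c Fc; apply: contrapT => Sc.
have [g mg] : exists g, minpoly (hom_dom S) c g.
  apply: minpoly_ex; first exact: hg_dom.
  by apply: alg_closureS Fc => x [y Rxy]; exists y; exact: RS.
have [mo Fg _ _] := mg.
have [g' gg'] := poly_graph_ex hS Fg.
have /closed_rootP[c' gc'] : size g' != 1%N.
  by rewrite (poly_graph_size hS mo gg') neq_ltn (minpoly_size mg) orbT.
apply: (maxS (ext_graph S c c')).
  split; first exact: (ext_graph_sub hS).
  by move=> sub; apply: Sc; exists c'; apply: sub; exact: (ext_graph_pt hS).
right; split; first exact: (ext_graphP hS mg gg' gc').
exact: subset_trans RS (ext_graph_sub hS _ _).
Qed.

End Extension.

(** * Automorphisms of an algebraic closure *)

Lemma build_rmorph (A B : fieldType) (f : A -> B) : f 1 = 1 ->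
  (forall x y, f (x - y) = f x - f y) -> (forall x y, f (x * y) = f x * f y) ->
  exists s : {rmorphism A -> B}, s =1 f.
Proof.
move=> f1 fB fM.
pose zm := GRing.isZmodMorphism.Build A B f fB.
pose mm := GRing.isMonoidMorphism.Build A B f (f1, fM).
by exists (HB.pack f zm mm : {rmorphism A -> B}).
Qed.

(* Compactness, by an ultrafilter limit along the finite sets. *)
Lemma finite_limit (T : eqType) (f : seq T -> T -> T) :
  (forall x, exists l : seq T, forall S, f S x \in l) ->
  exists g : T -> T, forall S : seq T, exists S' : seq T,
    {subset S <= S'} /\ {in S, forall x, f S' x = g x}.
Proof.
move=> fin; pose cone (S : seq T) := [set S' : seq T | {subset S <= S'}].
have FF : ProperFilter (filter_from setT cone).
  apply: filter_from_proper; last by move=> S _; exists S.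
  apply: filter_from_filter; first by exists [::].
  move=> S S' _ _; exists (S ++ S') => // Z SZ.
  by split=> x xS; apply: SZ; rewrite mem_cat xS ?orbT.
have [U [UU sU]] := ultraFilterLemma FF.
have FU := @ultra_proper _ U UU.
have Ucone S : U (cone S) by apply: sU; exists S.
have /choice[g Ug] : forall x, exists y, U [set S | f S x = y].
  move=> x; have [l fl] := fin x.
  have : U [set S | f S x \in l] by apply: filterS filterT => S _ /=.
  elim: l {fl} => [|y l IH] Ul.
    by exfalso; apply: (@filter_not_empty _ U FU); apply: filterS Ul => S.
  have [Uy|Uy] := in_ultra_setVsetC [set S | f S x = y] UU; first by exists y.
  apply: IH; apply: filterS (filterI Ul Uy) => S /= [].
  by rewrite inE => /orP[/eqP->|//].
exists g => S.
have : U (cone S `&` [set S' : seq T | {in S, forall x, f S' x = g x}]).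
  apply: filterI; first exact: Ucone.
  elim: S => [|x S IH]; first by apply: filterS filterT.
  apply: filterS (filterI (Ug x) IH) => S' [/= ex eS] y.
  by rewrite inE => /orP[/eqP->|/eS].
by move=> /filter_ex[S' [a b]]; exists S'.
Qed.

Section Autom.
Variable Om : closedFieldType.
Implicit Types (F : set Om) (s t : {rmorphism Om -> Om}) (x y z : Om).

Definition aut_over F : set {rmorphism Om -> Om} :=
  [set s : {rmorphism Om -> Om} | forall x, F x -> s x = x].

Definition algebraic_over F := forall x, alg_closure_in F x.

Lemma algebraic_overS F F' : F `<=` F' -> algebraic_over F -> algebraic_over F'.
Proof. by move=> FF aF x; apply: alg_closureS FF _ (aF x). Qed.

Lemma aut_overS F F' : F `<=` F' -> aut_over F' `<=` aut_over F.
Proof. by move=> FF s sF x /FF/sF. Qed.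

Lemma aut_over_comp F s t : aut_over F s -> aut_over F t -> aut_over F (s \o t).
Proof. by move=> sF tF x Fx /=; rewrite tF ?sF. Qed.

Lemma aut_over_id F : aut_over F idfun. Proof. by []. Qed.

Lemma aut_root F s p x : aut_over F s -> polyIn F p -> root p x -> root p (s x).
Proof.
move=> sF Fp px; have -> : p = map_poly s p.
  by apply/polyP => i; rewrite coef_map /= sF.
by rewrite /root horner_map (rootP px) rmorph0.
Qed.

Lemma root_seq (p : {poly Om}) : p != 0 -> exists l : seq Om, forall x, root p x -> x \in l.
Proof.
move=> p0; have [l e] := closed_field_poly_normal p; exists l => x.
by rewrite e rootZ ?lead_coef_eq0 // root_prod_XsubC.
Qed.

Lemma finite_orbit F x : alg_closure_in F x ->
  exists l : seq Om, forall s, aut_over F s -> s x \in l.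
Proof.
move=> [p [p0 Fp px]]; have [l lp] := root_seq p0.
by exists l => s sF; apply: lp; exact: (aut_root sF).
Qed.

(** Being injective, s permutes the finite set of roots of each polynomial over F, and hence is
    surjective. *)
Lemma aut_over_inv F s : algebraic_over F -> aut_over F s ->
  exists t, [/\ aut_over F t, cancel s t & cancel t s].
Proof.
move=> aF sF; have sur y : exists x, s x = y.
  have [p [p0 Fp py]] := aF y; have [l lp] := root_seq p0.
  pose r := undup [seq z <- l | root p z].
  have rP z : (z \in r) = root p z.
    by rewrite mem_undup mem_filter; case: (boolP (root p z)) => //= /lp ->.
  have sub : {subset map s r <= r}.
    by move=> _ /mapP[z + ->]; rewrite !rP; exact: (aut_root sF Fp).
  have us : uniq (map s r) by rewrite map_inj_uniq ?undup_uniq //; exact: (@fmorph_inj _ _ s).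
  have [|_ e] := uniq_min_size us sub; first by rewrite size_map.
  have : y \in map s r by rewrite e rP.
  by case/mapP => x _ ->; exists x.
have [f fK] := choice sur; have sK : cancel s f.
  by move=> x; apply: (@fmorph_inj _ _ s); rewrite fK.
have [|||t tf] := @build_rmorph _ _ f.
- by rewrite -[in LHS](rmorph1 s) sK.
- by move=> x y; apply: (@fmorph_inj _ _ s); rewrite rmorphB !fK.
- by move=> x y; apply: (@fmorph_inj _ _ s); rewrite rmorphM !fK.
exists t; split=> x; rewrite tf //.
by move=> Fx; rewrite -{1}(sF x Fx) sK.
Qed.

(** Orbits are finite, so the automorphisms chosen for the finite sets S have a limit. Each law of a
    homomorphism and each instance of Q involves at most three elements, on which the limit agrees
    with one of these automorphisms. *)
Lemma aut_compact F (Q : Om -> Om -> Prop) : algebraic_over F ->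
  (forall S : seq Om, exists2 s, aut_over F s & forall x, x \in S -> Q x (s x)) ->
  exists2 s, aut_over F s & forall x, Q x (s x).
Proof.
move=> aF sQ.
have /choice[f Pf] (S : seq Om) : exists s, aut_over F s /\ forall x, x \in S -> Q x (s x).
  by have [s] := sQ S; exists s.
have [g gP] : exists g : Om -> Om, forall S : seq Om, exists S' : seq Om,
    {subset S <= S'} /\ {in S, forall x, f S' x = g x}.
  apply: finite_limit => x; have [l lx] := finite_orbit (aF x).
  by exists l => S; apply: lx; exact: (Pf S).1.
have gP3 x y z : exists S, [/\ f S x = g x, f S y = g y, f S z = g z & x \in S].
  have [S [SS eS]] := gP [:: x; y; z].
  by exists S; rewrite !eS ?SS ?inE ?eqxx ?orbT.
have [|||s sg] := @build_rmorph _ _ g.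
- by have [S [<- _ _ _]] := gP3 1 1 1; rewrite rmorph1.
- by move=> x y; have [S [<- <- <- _]] := gP3 (x - y) x y; rewrite rmorphB.
- by move=> x y; have [S [<- <- <- _]] := gP3 (x * y) x y; rewrite rmorphM.
exists s => x; rewrite sg; have [S [<- _ _ xS]] := gP3 x x x; last exact: (Pf S).2.
by move=> Fx; exact: (Pf S).1.
Qed.

Lemma hom_graph_total (S : set (Om * Om)) : hom_graph S ->
  (forall x, hom_dom S x) -> exists s : {rmorphism Om -> Om}, forall x, S (x, s x).
Proof.
move=> hS /choice[f Sf].
have [|||s sf] := @build_rmorph _ _ f.
- exact: (hg_fun hS (Sf 1) (hg1 hS)).
- by move=> x y; apply: (hg_fun hS (Sf _)); apply: hgB.
- by move=> x y; apply: (hg_fun hS (Sf _)); apply: hgM.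
by exists s => x; rewrite sf.
Qed.

(** Write g = k * g' with g' the minimal polynomial of z. Then x is a root of k or of g'. The first
    case is excluded by degrees; in the second, g and g' are monic and divide each other. *)
Lemma minpoly_conj F x z g : subfield F -> minpoly F x g -> root g z -> minpoly F z g.
Proof.
move=> sF mg gz; have [mo Fg gx mi] := mg.
have [|gz' mz] := @minpoly_ex _ F sF z.
  by exists g; split=> //; exact: monic_neq0.
have [mo' Fg' gz'0 mi'] := mz; have [k Fk e] := mi' g Fg gz.
suff -> : g = gz' by [].
have k0 : k != 0 by apply: contraTneq (monic_neq0 mo) => k0; rewrite e k0 mul0r eqxx.
move: gx; rewrite {1}e rootM => /orP[kx|zx].
  have [l Fl e'] := mi k Fk kx.
  have: size (k * gz') = size k.
    apply/eqP; rewrite eqn_leq -{1}e; apply/andP; split.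
      rewrite e' size_Mmonic // ?leq_pred //; last first.
        by apply: contraNneq k0 => l0; rewrite e' l0 mul0r.
      have : (0 < size l)%N.
        by rewrite size_poly_gt0; apply: contraNneq k0 => l0; rewrite e' l0 mul0r.
      by case: (size l) => // n _; rewrite addSn /= leq_addl.
    rewrite size_Mmonic // -ltnS prednK; first by rewrite -addn1 leq_add2l; exact: (ltnW (minpoly_size mz)).
    by rewrite addn_gt0 size_poly_gt0 k0.
  rewrite size_Mmonic // => kk; exfalso; move: kk k0 (minpoly_size mz).
  by rewrite -size_poly_gt0; lia.
have [l Fl e'] := mi gz' Fg' zx.
have l0 : l != 0 by apply: contraTneq (monic_neq0 mo') => l0; rewrite e' l0 mul0r eqxx.
have lk : l * k = 1.
  apply: (mulIf (monic_neq0 mo)); rewrite mul1r -mulrA [k * g]mulrC mulrA -e' [RHS]e.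
  by rewrite mulrC.
have sk : size k == 1%N.
  have := congr1 (fun p : {poly Om} => size p) lk; rewrite size_mul // size_polyC oner_eq0 /=.
  by move: k0 l0; rewrite -!size_poly_gt0; move: (size k) (size l) => m n; lia.
have ek : k = (k`_0)%:P by apply: size1_polyC; rewrite (eqP sk).
have : lead_coef g = 1 by exact/monicP.
rewrite e ek mul_polyC lead_coefZ (monicP mo') mulr1 => ->.
by rewrite scale1r.
Qed.

(** The result is a partial homomorphism, because it is also applied over subfields that may consist
    of constants, where Om is not algebraic. *)
Lemma hom_graph_move F x z g : subfield F -> minpoly F x g -> root g z ->
  exists S : set (Om * Om), [/\ hom_graph S, forall y, F y -> S (y, y), S (x, z)
    & alg_closure_in F `<=` hom_dom S].
Proof.
move=> sF mg gz; pose R : set (Om * Om) := [set xy | F xy.1 /\ xy.1 = xy.2].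
have dR : hom_dom R = F.
  by apply/seteqP; split=> [y [y' []]|y Fy] //; exists y.
have hR : hom_graph R.
  split; first by split; [exact: sf1|].
  - by move=> a b c e [/= Fa <-] [/= Fb <-]; split => //; exact: sfB.
  - by move=> a b c e [/= Fa <-] [/= Fb <-]; split => //; exact: sf_div.
  - by move=> y [/= _ <-].
rewrite -dR in mg.
have gg : poly_graph R g g by move=> i; case: mg => _; rewrite dR => Fg _ _; split=> //=; exact: Fg.
have [S [hS RS dS]] := hom_graph_extend (ext_graphP hR mg gg gz).
have sub := ext_graph_sub hR x z.
exists S; split=> //.
- by move=> y Fy; apply/RS/sub.
- exact/RS/ext_graph_pt.
- apply: subset_trans dS; apply: alg_closureS => y Fy.
  by exists y; exact: sub.
Qed.

Lemma aut_move F x z g : subfield F -> algebraic_over F -> minpoly F x g -> root g z ->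
  exists2 s, aut_over F s & s x = z.
Proof.
move=> sF aF mg gz; have [S [hS FS Sxz dS]] := hom_graph_move sF mg gz.
have [s Ss] := hom_graph_total hS (fun y => dS y (aF y)).
exists s; last exact: (hg_fun hS (Ss x) Sxz).
by move=> y /FS; apply: (hg_fun hS).
Qed.

End Autom.

(** * Conjugates and purely inseparable powers *)

Section SeparablePower.
Variable Om : closedFieldType.
Implicit Types (F : set Om) (x y z : Om).

Lemma minpoly_other F x g rs : subfield F -> minpoly F x g ->
  g = \prod_(z <- rs) ('X - z%:P) -> uniq rs ->
  F x \/ exists2 z, root g z & z != x.
Proof.
move=> sF [mo Fg gx _] e urs.
have [[z gz zx]|no] := pselect (exists2 z, root g z & z != x).
  by right; exists z.
left; have rP z : z \in rs -> z = x.
  move=> zr; have [//|zx] := eqVneq z x; exfalso; apply: no; exists z => //.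
  by rewrite e root_prod_XsubC.
have xr : x \in rs by rewrite -root_prod_XsubC -e.
have sr : (size rs <= 1)%N by apply: (@uniq_leq_size _ rs [:: x]) => // z /rP ->; rewrite inE.
have ers : rs = [:: x].
  by case: rs sr xr {e urs rP} => [|y [|//]] // _; rewrite inE => /eqP ->.
have := Fg 0; rewrite e ers big_seq1 coefB coefX coefC /= sub0r => Fx.
by rewrite -[x]opprK; exact: sfN.
Qed.

Lemma separable_other F x p : subfield F -> polyIn F p -> separable_poly p ->
  root p x -> F x \/ exists g, minpoly F x g /\ exists2 z, root g z & z != x.
Proof.
move=> sF Fp sp px.
have p0 : p != 0 by exact: separable_poly_neq0.
have [|g mg] := @minpoly_ex _ F sF x; first by exists p.
have [mo _ _ mi] := mg; have [k _ ep] := mi p Fp px.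
have [rs e] := closed_field_poly_normal g; rewrite (monicP mo) scale1r in e.
have urs : uniq rs.
  by rewrite -separable_prod_XsubC -e; apply: dvdp_separable sp; rewrite ep dvdp_mull.
have [|ex] := minpoly_other sF mg e urs; first by left.
by right; exists g.
Qed.

(* q is chosen such that x^q has minimal degree over F. *)
Lemma separable_power F x : subfield F -> alg_closure_in F x ->
  exists q g rs, [/\ [pchar Om].-nat q, minpoly F (x ^+ q) g,
    g = \prod_(z <- rs) ('X - z%:P) & uniq rs].
Proof.
move=> sF ax; pose P n := `[< exists q g,
  [/\ [pchar Om].-nat q, minpoly F (x ^+ q) g & size g = n] >].
have [n /asboolP[q [g [qp mg sg]]] minn] :
    exists2 n, P n & forall m, P m -> (n <= m)%N.
  have exP : exists n, P n.
    have [g mg] := minpoly_ex sF ax.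
    by exists (size g); apply/asboolP; exists 1%N, g; rewrite expr1.
  by exists (ex_minn exP); case: ex_minnP.
have [rs e] := closed_field_poly_normal g.
have [mo Fg gx mi] := mg; rewrite (monicP mo) scale1r in e.
exists q, g, rs; split=> //; rewrite -separable_prod_XsubC -e.
have Fdg : polyIn F g^`().
  move=> i; rewrite coef_deriv; move: (Fg i.+1); move: (g`_i.+1) => c; move: (i.+1) => m Fc.
  elim: m => [|m IH]; first by rewrite mulr0n; exact: sf0.
  by rewrite mulrS; apply: sfD.
have [dg0|dg0] := eqVneq g^`() 0; last first.
  (* Every root of g has g as its minimal polynomial, so it cannot be a root of a nonzero
     derivative, which is smaller. *)
  rewrite unlock; apply/Pdiv.ClosedField.coprimepP => z gz; apply: contra_neqT dg0 => /negPn dgz.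
  apply: (minpoly_small (minpoly_conj sF mg gz)) => //.
  by apply: lt_size_deriv; exact: monic_neq0.
(* A vanishing derivative makes g a polynomial h in ['X^p]; then h annihilates x^(q p) and has
   smaller degree, against the choice of q. *)
exfalso; have sg1 := minpoly_size mg.
have co i : g`_i *+ i = 0.
  by case: i => [|i]; [rewrite mulr0n|rewrite -coef_deriv dg0 coef0].
have [p pp] : exists p, p \in [pchar Om].
  apply: (@natf0_pchar _ (size g).-1); first by lia.
  by have := co (size g).-1; rewrite -lead_coefE (monicP mo) => ->.
have p1 : (1 < p)%N by apply: prime_gt1; exact: pcharf_prime pp.
have p0 : (0 < p)%N by exact: ltnW.
pose h := \poly_(i < (size g).-1) g`_(i * p).
have eh : g = h \Po 'X^p.
  apply/polyP => i; rewrite coef_comp_poly_Xn // coef_poly.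
  case: dvdnP => [[k ->]|ndiv].
    rewrite mulnK //; case: ltnP => // lek; apply: nth_default.
    case: k lek => [|k] lek; first by move: sg1 lek; move: (size g) => m; lia.
    by apply: leq_trans (_ : (k.+1 * 2 <= _)%N); [move: sg1 lek; move: (size g) => m; lia|rewrite leq_mul2l p1].
  apply/eqP; have := co i; rewrite -mulr_natr => /eqP.
  rewrite mulf_eq0 -(dvdn_pcharf pp) => /orP[//|/dvdnP].
  by case=> k e'; case: ndiv; exists k.
have h0 : h != 0 by apply: contraTneq (monic_neq0 mo) => h0; rewrite eh h0 comp_poly0 eqxx.
have Fh : polyIn F h.
  by move=> i; rewrite coef_poly; case: ifP => _; [exact: Fg|exact: sf0].
have hx : root h (x ^+ (q * p)).
  by rewrite exprM /root; move: gx; rewrite eh /root horner_comp hornerXn.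
have [|g' mg'] := @minpoly_ex _ F sF (x ^+ (q * p)); first by exists h.
have : (n <= size g')%N.
  apply: minn; apply/asboolP; exists (q * p)%N, g'; split=> //.
  by rewrite pnatM qp pnatE ?(pcharf_prime pp).
have [mo' _ _ mi'] := mg'; have [k _ ek] := mi' h Fh hx.
have : (size g' <= size h)%N.
  have k0 : k != 0 by apply: contraNneq h0 => k0; rewrite ek k0 mul0r.
  rewrite ek size_Mmonic //; move: k0; rewrite -size_poly_gt0.
  by case: (size k) => // m _; rewrite addSn leq_addl.
have : (size h <= (size g).-1)%N by exact: size_poly.
by move: sg1; rewrite sg; lia.
Qed.

Lemma power_or_other F x : subfield F -> alg_closure_in F x ->
  (exists2 q, [pchar Om].-nat q & F (x ^+ q)) \/
  (exists q g z, [/\ [pchar Om].-nat q, minpoly F (x ^+ q) g, root g z & z != x ^+ q]).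
Proof.
move=> sF ax; have [q [g [rs [qp mg e urs]]]] := separable_power sF ax.
have [Fx|[z gz zx]] := minpoly_other sF mg e urs; first by left; exists q.
by right; exists q, g, z.
Qed.

(** Otherwise some x^q has a conjugate different from itself, and an automorphism over F moves
    it. *)
Lemma fixed_power F x : subfield F -> algebraic_over F ->
  (forall s, aut_over F s -> s x = x) -> exists2 q, [pchar Om].-nat q & F (x ^+ q).
Proof.
move=> sF aF fx; have [//|[q [g [z [qp mg gz zx]]]]] := power_or_other sF (aF x).
have [s sA sz] := aut_move sF aF mg gz.
by move: zx; rewrite -sz rmorphXn fx ?eqxx.
Qed.

Lemma pchar_nat_gt0 q : [pchar Om].-nat q -> (0 < q)%N.
Proof. by case/andP. Qed.

End SeparablePower.

(** * Valuation rings *)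

Section FieldGen.
Variable Om : fieldType.
Implicit Types (A L F : set Om) (x y : Om).

Lemma field_gen_subfield A : subfield (field_gen A).
Proof.
split.
- by move=> L [sL _]; exact: sf1.
- by move=> x y gx gy L LP; apply: sfB; [case: LP|exact: gx|exact: gy].
- by move=> x y gx gy L LP; apply: sf_div; [case: LP|exact: gx|exact: gy].
Qed.

Lemma field_gen_ge A : A `<=` field_gen A.
Proof. by move=> x Ax L [_]; apply. Qed.

Lemma field_gen_le A L : subfield L -> A `<=` L -> field_gen A `<=` L.
Proof. by move=> sL AL x; apply. Qed.

Lemma subfield_eq (Om' : fieldType) (s t : {rmorphism Om -> Om'}) :
  subfield [set x | s x = t x].
Proof.
split=> /=; first by rewrite !rmorph1.
- by move=> x y ex ey; rewrite !rmorphB ex ey.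
- by move=> x y ex ey; rewrite !fmorph_div ex ey.
Qed.

End FieldGen.

Section ValuationRing.
Variable Om : fieldType.
Implicit Types (V : set Om) (x y : Om).

Definition vring V := [/\ V 1, forall x y, V x -> V y -> V (x - y),
  forall x y, V x -> V y -> V (x * y) & forall x, V x \/ V x^-1].

(** The maximal ideal of V. The case x = 0 is separate because 0^-1 = 0 lies in V. *)
Definition vmax V x := x = 0 \/ ~ V x^-1.

Section OneRing.
Variable V : set Om.
Hypothesis vV : vring V.

Lemma vr1 : V 1. Proof. by case: vV. Qed.
Lemma vrB x y : V x -> V y -> V (x - y). Proof. by case: vV => _ + _ _; apply. Qed.
Lemma vrM x y : V x -> V y -> V (x * y). Proof. by case: vV => _ _ + _; apply. Qed.
Lemma vrV x : ~ V x -> V x^-1. Proof. by case: vV => _ _ _ /(_ x)[]. Qed.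
Lemma vr0 : V 0. Proof. by rewrite -(subrr 1); apply: vrB; exact: vr1. Qed.
Lemma vrN x : V x -> V (- x).
Proof. by move=> Vx; rewrite -sub0r; apply: vrB => //; exact: vr0. Qed.
Lemma vrD x y : V x -> V y -> V (x + y).
Proof. by move=> Vx Vy; rewrite -[y]opprK; apply: vrB => //; exact: vrN. Qed.
Lemma vrX x n : V x -> V (x ^+ n).
Proof.
by move=> Vx; elim: n => [|n IH]; rewrite ?expr0 ?exprS; [exact: vr1|exact: vrM].
Qed.

Lemma vmax_vr x : vmax V x -> V x.
Proof. by case=> [->|/vrV]; [exact: vr0|rewrite invrK]. Qed.

Lemma vmax0 : vmax V 0. Proof. by left. Qed.

Lemma vmaxM x y : vmax V x -> V y -> vmax V (x * y).
Proof.
move=> mx Vy; have [->|y0] := eqVneq y 0; first by left; rewrite mulr0.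
case: mx => [->|nx]; first by left; rewrite mul0r.
right=> Vxy; apply: nx; have := vrM Vxy Vy.
by rewrite invfM -mulrA mulVf // mulr1.
Qed.

Lemma vmaxN x : vmax V x -> vmax V (- x).
Proof. by move=> mx; rewrite -mulrN1; apply: vmaxM => //; apply: vrN; exact: vr1. Qed.

Lemma vmaxD x y : vmax V x -> vmax V y -> vmax V (x + y).
Proof.
move=> mx my; have [->|x0] := eqVneq x 0; first by rewrite add0r.
have [->|y0] := eqVneq y 0; first by rewrite addr0.
have [Vxy|/vrV] := pselect (V (x / y)).
  have -> : x + y = y * (x / y + 1) by rewrite mulrDr mulr1 mulrC divfK.
  by apply: vmaxM => //; apply: vrD => //; exact: vr1.
rewrite invf_div => Vyx; have -> : x + y = x * (1 + y / x).
  by rewrite mulrDr mulr1 mulrC divfK.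
by apply: vmaxM => //; apply: vrD => //; exact: vr1.
Qed.

Lemma vmaxB x y : vmax V x -> vmax V y -> vmax V (x - y).
Proof. by move=> mx my; apply: vmaxD => //; exact: vmaxN. Qed.

Lemma vmax_sum (I : Type) (r : seq I) (P : pred I) (E : I -> Om) :
  (forall i, P i -> vmax V (E i)) -> vmax V (\sum_(i <- r | P i) E i).
Proof. by move=> ME; elim/big_rec: _ => [|i x /ME]; [exact: vmax0|exact: vmaxD]. Qed.

Lemma vmax1 : ~ vmax V 1.
Proof. by case=> [/eqP|]; rewrite ?oner_eq0 // invr1 => /(_ vr1). Qed.

Lemma vmaxV x : ~ V x -> vmax V x^-1.
Proof. by move=> nx; right; rewrite invrK. Qed.

Lemma not_vmax x : ~ vmax V x -> V x^-1.
Proof. by move=> nx; apply: contrapT => nV; apply: nx; right. Qed.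

Lemma vmax_one x : vmax V (x - 1) -> ~ vmax V x.
Proof. by move=> mx1 mx; apply: vmax1; rewrite -(subKr x 1); exact: vmaxB. Qed.

Lemma vmax_exp x n : (0 < n)%N -> vmax V x -> vmax V (x ^+ n).
Proof.
case: n => // n _ mx; rewrite exprS; apply: vmaxM => //.
by apply: vrX; exact: vmax_vr.
Qed.

Lemma vmax_root x n : vmax V (x ^+ n) -> vmax V x.
Proof.
case=> [/eqP|nx]; first by rewrite expf_eq0 => /andP[_ /eqP ->]; left.
by right=> Vx; apply: nx; rewrite -exprVn; exact: vrX.
Qed.

End OneRing.

(* The terms [1 + crt_poly x n] are pairwise coprime polynomials in x over the
   integers, so that each residue of x is a zero of at most one of them. *)
Fixpoint crt_poly x n := if n is m.+1 then crt_poly x m * (1 + crt_poly x m) else x.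

Lemma crt_poly_sf L x n : subfield L -> L x -> L (crt_poly x n).
Proof.
move=> sL Lx; elim: n => [//|n IH] /=.
by apply: sfM => //; apply: sfD => //; exact: sf1.
Qed.

Lemma crt_poly_vr V x n : vring V -> V x -> V (crt_poly x n).
Proof.
move=> vV Vx; elim: n => [//|n IH] /=.
by apply: vrM => //; apply: vrD => //; exact: vr1.
Qed.

Lemma crt_poly_max V x n : vring V -> vmax V x -> vmax V (crt_poly x n).
Proof.
move=> vV Vx; elim: n => [//|n IH] /=.
apply: vmaxM => //; apply: vrD => //; first exact: vr1.
exact: vmax_vr.
Qed.

Lemma crt_poly_out V x n : vring V -> ~ V x -> ~ V (crt_poly x n).
Proof.
move=> vV Vx; elim: n => [//|n IH] /= VP.
have V1 : ~ V (1 + crt_poly x n).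
  by move=> V1; apply: IH; rewrite -(addKr 1 (crt_poly x n)) addrC;
    apply: vrB => //; exact: vr1.
apply: (vmax1 vV); have := vmaxM vV (vmaxV V1) (vmax_vr vV (vmaxV IH)).
rewrite -invfM [_ * crt_poly x n]mulrC => /(vmaxM vV)/(_ VP); rewrite mulVf //.
by apply/eqP => e; apply: V1; move/eqP: (e); rewrite mulf_eq0 => /orP[/eqP e0|/eqP ->];
  [exfalso; apply: IH; rewrite e0; exact: vr0|exact: vr0].
Qed.

(** Once 1 + P_k lies in the maximal ideal, so does its multiple P_(k+1), and then every later P_n;
    for these n, 1 + P_n is congruent to 1. *)
Lemma crt_poly_bad V x : vring V -> V x ->
  exists N, forall n, (N <= n)%N -> ~ vmax V (1 + crt_poly x n).
Proof.
move=> vV Vx.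
have [[k mk]|no] := pselect (exists k, vmax V (1 + crt_poly x k)); last first.
  by exists 0 => n _ mn; apply: no; exists n.
have mP n : (k < n)%N -> vmax V (crt_poly x n).
  elim: n => // n IH; rewrite ltnS leq_eqVlt => /orP[/eqP <-|/IH mn] /=.
    by rewrite mulrC; apply: vmaxM => //; exact: crt_poly_vr.
  apply: vmaxM => //; apply: vrD => //; first exact: vr1.
  exact: vmax_vr.
exists k.+1 => n /mP mn; apply: vmax_one => //.
by rewrite addrAC subrr add0r.
Qed.

(** Take u = 1 / (1 + P_n) with P_n = [crt_poly x n]. Like x, the element P_n is in the maximal
    ideal or outside the ring; in the rings that contain x, 1 + P_n is a unit for large n. The
    simpler 1 / (1 + x) fails where x is congruent to -1. *)
Lemma crt_one (I : finType) (V : I -> set Om) x : (forall i, vring (V i)) ->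
  exists u, (forall L, subfield L -> L x -> L u) /\ forall i,
    [/\ V i u, vmax (V i) x -> vmax (V i) (u - 1) & ~ V i x -> vmax (V i) u].
Proof.
move=> vV; have /choice[N NP] i : exists N, V i x -> forall n, (N <= n)%N ->
    ~ vmax (V i) (1 + crt_poly x n).
  have [/(crt_poly_bad (vV i))[N NP]|nV] := pselect (V i x); first by exists N.
  by exists 0.
pose n := \max_i N i; pose q := 1 + crt_poly x n.
exists q^-1; split=> [L sL Lx|i].
  by apply: sfV => //; apply: sfD; [|exact: sf1|exact: crt_poly_sf].
have out : ~ V i x -> vmax (V i) q^-1.
  move=> nx; apply: vmaxV => // Vq; apply: (crt_poly_out (n := n) (vV i) nx).
  by rewrite -(addKr 1 (crt_poly x n)) addrC; apply: vrB => //; exact: vr1.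
have inn : V i x -> V i q^-1.
  by move=> Vx; apply: not_vmax => //; apply: NP => //; exact: leq_bigmax.
split=> //.
  by have [/inn//|/out] := pselect (V i x); exact: vmax_vr.
move=> mx; have Vx : V i x by exact: vmax_vr.
have q0 : q != 0.
  by apply/eqP => q0; apply: (NP i Vx n (leq_bigmax i)); left.
have -> : q^-1 - 1 = - (crt_poly x n * q^-1).
  by apply: (mulIf q0); rewrite mulrBl mulNr mulVf // -mulrA mulVf // mulr1 mul1r /q opprD addrA subrr add0r.
by apply: vmaxN => //; apply: vmaxM => //; [exact: crt_poly_max|exact: inn].
Qed.

(** Valuation rings lying over the same ring of F are incomparable. If x is in V' but not in V,
    divide p(x) = 0 by its term of index i, where p_i has minimal value with the largest possible
    index. The terms below i are in the maximal ideal of V because x^-1 is. For j > i, the quotient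
    p_j / p_i is in the maximal ideal of V, hence in that of V' by agreement on F, and remains there
    when multiplied by a power of x; on M, the maximal ideal of V' is contained in that of V. So 1
    would be in the maximal ideal of V. *)
Lemma vring_nested (V V' : set Om) (F M : set Om) : vring V -> vring V' ->
  subfield F -> subfield M -> F `<=` M -> (forall x, M x -> alg_closure_in F x) ->
  (forall x, F x -> V x <-> V' x) -> (forall x, M x -> V x -> V' x) ->
  forall x, M x -> V' x -> V x.
Proof.
move=> vV vV' sF sM FM aM eF sub x Mx V'x; apply: contrapT => nVx.
have mV' y : M y -> vmax V' y -> vmax V y.
  move=> My [->|nV]; [by left|right=> Vy; apply: nV; apply: sub => //; exact: sfV].
have [p [p0 Fp px]] := aM x Mx.
(* a coefficient of minimal value, with the largest possible index *)
have lead n : (exists2 i, (i < n)%N & p`_i != 0) -> exists i, [/\ (i < n)%N, p`_i != 0,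
    forall j, (j < n)%N -> V (p`_j / p`_i) &
    forall j, (i < j < n)%N -> vmax V (p`_j / p`_i)].
  elim: n => [[]//|n IH] [k kn pk].
  have [/IH[i [ilt pi Vi mi]]|no] := pselect (exists2 i, (i < n)%N & p`_i != 0).
    have [mn|nmn] := pselect (vmax V (p`_n / p`_i)).
      exists i; split=> //; first exact: ltnW.
        by move=> j; rewrite ltnS leq_eqVlt => /orP[/eqP ->|/Vi//]; exact: vmax_vr.
      move=> j /andP[ij]; rewrite ltnS leq_eqVlt => /orP[/eqP -> //|jn].
      by apply: mi; rewrite ij.
    have Vin : V (p`_i / p`_n) by rewrite -invf_div; apply: not_vmax.
    have pn : p`_n != 0 by apply/eqP => pn; apply: nmn; left; rewrite pn mul0r.
    exists n; split=> // [j|j /andP[nj]]; last by rewrite ltnS leqNgt nj.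
    rewrite ltnS leq_eqVlt => /orP[/eqP ->|/Vi Vj]; first by rewrite divff //; exact: vr1.
    by have := vrM vV Vj Vin; rewrite mulrA divfK.
  have z j : (j < n)%N -> p`_j = 0.
    by move=> jn; have [//|pj] := eqVneq p`_j 0; case: no; exists j.
  have pn : p`_n != 0.
    by move: kn pk; rewrite ltnS leq_eqVlt => /orP[/eqP -> //|/z ->]; rewrite eqxx.
  exists n; split=> // [j|j /andP[nj]]; last by rewrite ltnS leqNgt nj.
  rewrite ltnS leq_eqVlt => /orP[/eqP ->|/z ->]; first by rewrite divff //; exact: vr1.
  by rewrite mul0r; exact: vr0.
have [|i [ilt pi Vi mi]] := lead (size p).
  by exists (size p).-1; rewrite -?lead_coefE ?lead_coef_eq0 // prednK ?size_poly_gt0.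
have x0 : x != 0 by apply: contra_notN nVx => /eqP ->; exact: vr0.
have mxV : vmax V x^-1 by exact: vmaxV.
apply: (vmax1 vV).
have e : \sum_(j < size p) (p`_j / p`_i) * (x ^+ j / x ^+ i) = 0.
  transitivity (p.[x] / (p`_i * x ^+ i)); last by rewrite (rootP px) mul0r.
  by rewrite horner_coef mulr_suml; apply: eq_bigr => j _; rewrite invfM mulrACA.
have {e} -> : 1 = - \sum_(j < size p | j != Ordinal ilt) (p`_j / p`_i) * (x ^+ j / x ^+ i).
  apply/eqP; rewrite -addr_eq0 -[X in _ == X]e [X in _ == X](bigD1 (Ordinal ilt)) //=.
  by rewrite !divff ?expf_neq0 // mulr1.
apply: vmaxN => //; apply: vmax_sum => // j ji.
have [lt|gt|e] := ltngtP j i; last by move: ji; rewrite -val_eqE /= e eqxx.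
  rewrite mulrC; apply: vmaxM => //; last exact: Vi.
  rewrite -(subnK (ltnW lt)) exprD invfM mulrCA divff ?expf_neq0 // mulr1 -exprVn.
  by apply: vmax_exp; rewrite ?subn_gt0.
rewrite -(subnK (ltnW gt)) exprD mulfK ?expf_neq0 // subnK ?(ltnW gt) //.
have mF : vmax V (p`_j / p`_i) by apply: mi; rewrite gt /=.
have Fji : F (p`_j / p`_i) by apply: sf_div => //; exact: Fp.
apply: mV'; first by apply: sfM => //; [exact: FM|exact: sfX].
apply: vmaxM => //; last exact: vrX.
case: mF => [->|nV]; [by left|right=> V'j; apply: nV; apply/eF => //; exact: sfV].
Qed.

End ValuationRing.

(** * Conjugacy of valuations *)

Section Conjugacy.
Variable Om : closedFieldType.
Implicit Types (V F : set Om) (s t : {rmorphism Om -> Om}) (x y : Om).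

Lemma vring_preim V s : vring V -> vring (s @^-1` V).
Proof.
move=> vV; split=> /=; first by rewrite rmorph1; exact: vr1.
- by move=> x y; rewrite rmorphB; exact: vrB.
- by move=> x y; rewrite rmorphM; exact: vrM.
- by move=> x; rewrite fmorphV; case: vV => _ _ _; apply.
Qed.

Lemma vmax_preim V s x : vmax (s @^-1` V) x <-> vmax V (s x).
Proof.
rewrite /vmax /= fmorphV; split=> [[->|]|[/eqP|]]; [by left; rewrite rmorph0|by right| |by right].
by rewrite fmorph_eq0 => /eqP ->; left.
Qed.

Lemma finite_images F (S : seq Om) : algebraic_over F ->
  exists l : seq (seq Om), forall s, aut_over F s -> map s S \in l.
Proof.
move=> aF; elim: S => [|x S [l IH]]; first by exists [:: [::]].
have [lx lP] := finite_orbit (aF x).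
exists [seq y :: r | y <- lx, r <- l] => s sF /=.
by apply: allpairs_f; [exact: lP|exact: IH].
Qed.

Lemma finite_restrictions F (S : seq Om) : algebraic_over F ->
  exists N (sg : 'I_N -> {rmorphism Om -> Om}), (forall i, aut_over F (sg i)) /\
  forall s, aut_over F s -> exists i, forall x, x \in S -> s x = sg i x.
Proof.
move=> aF; have [l lP] := finite_images S aF.
have /choice[sg sgP] (i : 'I_(size l)) : exists s, aut_over F s /\
    forall t, aut_over F t -> map t S = nth [::] l i -> map s S = map t S.
  have [[s sF e]|no] := pselect (exists2 s, aut_over F s & map s S = nth [::] l i).
    by exists s; split=> // t _ ->.
  by exists idfun; split=> // t tF e; exfalso; apply: no; exists t.
exists (size l), sg; split=> [i|s sF]; first by case: (sgP i).
have il : (index (map s S) l < size l)%N by rewrite index_mem; exact: lP.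
exists (Ordinal il) => x xS; have [_ /(_ s sF)] := sgP (Ordinal il).
rewrite nth_index ?lP // => /(_ erefl) e.
have [n nS <-] := nthP 0 xS.
by have := congr1 (nth 0 ^~ n) e; rewrite /= !(nth_map 0) // => ->.
Qed.

Lemma exact_orbit F (A : set {rmorphism Om -> Om}) x : algebraic_over F ->
  A `<=` aut_over F ->
  exists2 l : seq Om, uniq l & forall y, y \in l <-> exists2 s, A s & s x = y.
Proof.
move=> aF AF; have [l lP] := finite_orbit (aF x).
exists (undup [seq y <- l | `[< exists2 s, A s & s x = y >]]).
  exact: undup_uniq.
move=> y; rewrite mem_undup mem_filter; split=> [/andP[/asboolP]//|ex].
by apply/andP; split; [exact/asboolP|case: ex => s /AF sF <-; exact: lP].
Qed.

Lemma orbit_poly (A : set {rmorphism Om -> Om}) x (l : seq Om) s :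
  (forall s t, A s -> A t -> A (s \o t)) -> uniq l ->
  (forall y, y \in l <-> exists2 s, A s & s x = y) -> A s ->
  map_poly s (\prod_(y <- l) ('X - y%:P)) = \prod_(y <- l) ('X - y%:P).
Proof.
move=> cA ul lP As; have sl y : y \in l -> s y \in l.
  by move=> /lP[r Ar <-]; apply/lP; exists (s \o r) => //; exact: cA.
rewrite rmorph_prod /=.
under eq_bigr do rewrite rmorphB /= map_polyX map_polyC /=.
rewrite -(big_map s predT (fun y => 'X - y%:P)); apply: perm_big.
have us : uniq (map s l) by rewrite map_inj_uniq //; exact: (@fmorph_inj _ _ s).
have sub : {subset map s l <= l} by move=> _ /mapP[y yl ->]; exact: sl.
have [|_ e] := uniq_min_size us sub; first by rewrite size_map.
exact: uniq_perm.
Qed.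

(** By incomparability there are y in V but not in V' and z in V' but not in V; their quotient y / z
    is the required element. *)
Lemma vring_separate V V' F M : vring V -> vring V' -> subfield F -> subfield M ->
  F `<=` M -> algebraic_over F -> (forall x, F x -> V x <-> V' x) ->
  ~ (forall x, M x -> V x <-> V' x) -> exists t : Om, [/\ M t, vmax V t & ~ V' t].
Proof.
move=> vV vV' sF sM FM aF eF ne.
have out1 : exists2 y, M y & V y /\ ~ V' y.
  apply: contrapT => no1.
  have sub y : M y -> V y -> V' y.
    by move=> My Vy; apply: contrapT => nV'; apply: no1; exists y.
  apply: ne => x Mx; split; first exact: sub.
  exact: (vring_nested vV vV' sF sM FM (fun x _ => aF x) eF sub Mx).
have out2 : exists2 y, M y & ~ V y /\ V' y.
  apply: contrapT => no2.
  have sub y : M y -> V' y -> V y.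
    by move=> My Vy; apply: contrapT => nV'; apply: no2; exists y.
  case: out1 => y My [Vy []].
  exact: (vring_nested vV' vV sF sM FM (fun x _ => aF x)
    (fun z Fz => iff_sym (eF z Fz)) sub My Vy).
case: out1 => y My [Vy V'y]; case: out2 => z Mz [Vz V'z].
exists (y / z); split; first by apply: (sf_div sM).
  by rewrite mulrC; apply: (vmaxM vV) => //; exact: vmaxV.
move=> V'yz; have := vmaxM vV' (vmaxV V'y) V'z.
rewrite mulrC -[z]invrK -invfM mulrC; case=> [/eqP|]; last by rewrite !invrK.
rewrite invr_eq0 mulf_eq0 invr_eq0 => /orP[/eqP e|/eqP e].
  by apply: V'y; rewrite e; exact: vr0.
by apply: Vz; rewrite e; exact: vr0.
Qed.

(** Each t_i gives through [crt_one] an element congruent to 1 for V, small for V'_i and integral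
    for all the other rings; y is the product of these elements. *)
Lemma vring_approx (I : finType) V (V' : I -> set Om) M (t : I -> Om) : vring V ->
  (forall i, vring (V' i)) -> subfield M ->
  (forall i, [/\ M (t i), vmax V (t i) & ~ V' i (t i)]) ->
  exists y, [/\ M y, vmax V (y - 1) & forall i, vmax (V' i) y].
Proof.
move=> vV vV' sM tP; pose W (j : option I) := if j is Some i then V' i else V.
have vW j : vring (W j) by case: j.
have /choice[u uP] i := crt_one (t i) vW.
exists (\prod_i u i); split.
- by apply: (sf_prod sM) => i _; apply: (uP i).1 => //; case: (tP i).
- elim/big_rec: _ => [|i z _ mz]; first by rewrite subrr; exact: vmax0.
  have [_ mt _] := tP i; have [Vu /(_ mt) mu _] := (uP i).2 None.
  have -> : u i * z - 1 = (z - 1) * u i + (u i - 1).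
    by rewrite mulrBl mul1r [z * _]mulrC addrA addrNK.
  by apply: vmaxD => //; exact: vmaxM.
- move=> i; have [_ _ nt] := tP i; have [_ _ /(_ nt) mu] := (uP i).2 (Some i).
  rewrite (bigD1 i) //=; apply: (vmaxM (vV' i)) => //.
  elim/big_rec: _ => [|k z _ mz]; first exact: vr1.
  by apply: (vrM (vV' i)) => //; have [] := (uP k).2 (Some i).
Qed.

(* If no automorphism works on S, then some y is congruent to 1 modulo the
   maximal ideal of V, while all its conjugates lie in that of V'. The lower
   coefficients of its orbit polynomial are then in the maximal ideal of V',
   hence in that of V, which is absurd. *)
Theorem vring_conjugate V V' F : subfield F -> algebraic_over F -> vring V -> vring V' ->
  (forall x, F x -> V x <-> V' x) ->
  exists2 s, aut_over F s & forall x, V x <-> V' (s x).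
Proof.
move=> sF aF vV vV' eF.
apply: (aut_compact (Q := fun x y => V x <-> V' y)) => // S; apply: contrapT => no.
have {}no s : aut_over F s -> exists2 x, x \in S & ~ (V x <-> V' (s x)).
  move=> sA; apply: contrapT => no'; apply: no; exists s => // x xS.
  by apply: contrapT => nV; apply: no'; exists x.
pose M := field_gen (F `|` [set x | x \in S]).
have sM : subfield M by exact: field_gen_subfield.
have FM : F `<=` M by move=> x Fx; apply: field_gen_ge; left.
have SM x : x \in S -> M x by move=> xS; apply: field_gen_ge; right.
have [N [sg [sgF sgS]]] := finite_restrictions S aF.
have sgM s : aut_over F s -> exists i, forall x, M x -> s x = sg i x.
  move=> sA; have [i e] := sgS s sA; exists i => x.
  move: x; apply: field_gen_le; first exact: subfield_eq.
  by move=> x [Fx|/e//] /=; rewrite sA // sgF.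
have vsg i := vring_preim (sg i) vV'.
have eFi i x : F x -> V x <-> (sg i @^-1` V') x by move=> Fx /=; rewrite sgF //; exact: eF.
have /choice[t tP] i : exists t : Om, [/\ M t, vmax V t & ~ (sg i @^-1` V') t].
  apply: (vring_separate vV (vsg i) sF sM FM aF (eFi i)) => e.
  have [x xS nx] := no (sg i) (sgF i).
  exact: (nx (e x (SM x xS))).
have [y [My yV ymax]] := vring_approx vV vsg sM tP.
have yV' s : aut_over F s -> vmax V' (s y).
  move=> sA; have [i ->] := sgM s sA; last by [].
  by apply/vmax_preim; exact: ymax.
have [l ul lP] := exact_orbit y aF (@subset_refl _ (aut_over F)).
pose g := \prod_(z <- l) ('X - z%:P).
have gfix s : aut_over F s -> map_poly s g = g.
  by move=> sA; apply: (orbit_poly _ ul lP sA) => r r'; exact: aut_over_comp.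
have gV' i : (i < size l)%N -> vmax V' g`_i.
  have : forall z, z \in l -> vmax V' z by move=> z /lP[s sA <-]; exact: yV'.
  rewrite /g; elim: l i {ul lP g gfix} => // z l IH i lV' ilt.
  have [mz ml] : vmax V' z /\ forall z, z \in l -> vmax V' z.
    by split=> [|x xl]; apply: lV'; rewrite inE ?eqxx ?xl ?orbT.
  have gl j : V' (\prod_(z <- l) ('X - z%:P))`_j.
    have [lt|gt|->] := ltngtP j (size l); first by apply: vmax_vr => //; exact: IH.
      by rewrite nth_default ?size_prod_XsubC //; exact: vr0.
    have := lead_coef_prod_XsubC l predT id; rewrite lead_coefE size_prod_XsubC /= => ->.
    exact: vr1.
  rewrite big_cons mulrBl coefB coefXM coefCM.
  apply: vmaxB => //; last by apply: vmaxM.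
  by case: i ilt => [_|i ilt] /=; [exact: vmax0|exact: IH].
have gV i : (i < size l)%N -> vmax V g`_i.
  (* The coefficient is fixed by all automorphisms, so a power of it lies in F, where V and V'
     agree. *)
  move=> il; have [q qp Fq] : exists2 q, [pchar Om].-nat q & F (g`_i ^+ q).
    apply: fixed_power => // s /gfix {2}<-.
    by rewrite coef_map.
  apply: (@vmax_root _ V vV _ q).
  have [/eqP|nV'] := vmax_exp vV' (pchar_nat_gt0 qp) (gV' i il).
    by rewrite expf_eq0 => /andP[_ /eqP ->]; left; rewrite expr0n gtn_eqF // (pchar_nat_gt0 qp).
  by right=> /eF Vq; apply: nV'; apply: Vq; exact: sfV.
have gy : g.[y] = 0.
  apply/rootP; rewrite root_prod_XsubC; apply/lP.
  by exists idfun.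
have mp : g \is monic by rewrite monic_prod_XsubC.
have sg1 : size g = (size l).+1 by rewrite size_prod_XsubC.
have Vy : V y by rewrite -(subrK 1 y); apply: vrD => //; [exact: vmax_vr|exact: vr1].
apply: (vmax_one vV yV); apply: (@vmax_root _ V vV _ (size l)).
move: gy; rewrite horner_coef sg1 big_ord_recr /=.
have -> : g`_(size l) = 1 by have := monicP mp; rewrite lead_coefE sg1.
rewrite mul1r addrC => /eqP; rewrite addr_eq0 => /eqP ->.
apply: vmaxN => //; apply: vmax_sum => // i _; apply: vmaxM => //; first exact: gV.
exact: vrX.
Qed.

End Conjugacy.

(** * Decomposition groups *)

Section VringOf.
Variables (Om : fieldType) (G : oagType) (w : Om -> ext G).
Hypothesis dw : dval w.
Implicit Types (x y z : Om).

Definition vring_of : set Om := [set x | Fin 0 <= w x].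

Lemma dval_div_ge0 x y : y != 0 -> (Fin 0 <= w (x / y)) = (w y <= w x).
Proof.
move=> y0; rewrite -(ext_leD2 _ _ (dval_neqInf dw y0)) -dvalM // divfK //.
by rewrite -[Fin 0 + _]/(0 + w y) add0r.
Qed.

Lemma dval_div_gt0 x y : y != 0 -> (Fin 0 < w (x / y)) = (w y < w x).
Proof.
move=> y0; rewrite -(ext_ltD2r _ _ (dval_neqInf dw y0)) -dvalM // divfK //.
by rewrite -[Fin 0 + _]/(0 + w y) add0r.
Qed.

Lemma vring_ofP : vring vring_of.
Proof.
split; rewrite /vring_of /=; first by rewrite dval1.
- by move=> x y; exact: dval_leB.
- by move=> x y wx wy; rewrite dvalM // ext_addr_ge0.
- move=> x; have [->|x0] := eqVneq x 0; first by left; rewrite dval0.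
  have [|/ltW] := leP (Fin 0) (w x); first by left.
  by rewrite -div1r dval_div_ge0 // dval1 //; right.
Qed.

Lemma vmax_ofP x : vmax vring_of x <-> Fin 0 < w x.
Proof.
rewrite /vmax /vring_of /=; have [->|x0] := eqVneq x 0.
  by rewrite dval0 //; split=> // _; left.
rewrite -div1r dval_div_ge0 // dval1 // ltNge; split=> [[/eqP|/negP//]|/negP]; last by right.
by rewrite (negbTE x0).
Qed.

End VringOf.

Section Decomposition.
Variables (Om : closedFieldType) (G : oagType) (w : Om -> ext G).
Hypothesis dw : dval w.
Implicit Types (F L : set Om) (s t : {rmorphism Om -> Om}) (x y z : Om).

Lemma no_chain (f : nat -> Om) (l : seq Om) :
  (forall n, f n \in l) -> (forall n, w (f n) < w (f n.+1)) -> False.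
Proof.
move=> fl lt; have mono n m : (n < m)%N -> w (f n) < w (f m).
  elim: m => // m IH; rewrite ltnS leq_eqVlt => /orP[/eqP -> //|/IH nm].
  exact: lt_trans nm (lt m).
have u : uniq (map f (iota 0 (size l).+1)).
  rewrite map_inj_uniq ?iota_uniq // => n m e.
  by have [/mono|/mono|//] := ltngtP n m; rewrite e ltxx.
have /(uniq_leq_size u) : {subset map f (iota 0 (size l).+1) <= l}.
  by move=> _ /mapP[n _ ->].
by rewrite size_map size_iota ltnn.
Qed.

(** Preserving the valuation ring, s preserves strict inequalities between values. If w (s x)
    exceeded w x, iterating s would give infinitely many values on a finite orbit; the inverse of s
    yields the other inequality. *)
Lemma dval_aut F s : algebraic_over F -> aut_over F s ->
  (forall x, vring_of w x <-> vring_of w (s x)) -> forall x, w (s x) = w x.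
Proof.
have noinc t : algebraic_over F -> aut_over F t ->
    (forall x, vring_of w x <-> vring_of w (t x)) -> forall x, w (t x) <= w x.
  move=> aF tF et x; rewrite leNgt; apply/negP => lt.
  have mono a b : w a < w b -> w (t a) < w (t b).
    move=> ab; have a0 : a != 0 by rewrite -(dval_eqInf dw) (lt_neqInf ab).
    rewrite -dval_div_gt0 ?fmorph_eq0 // -fmorph_div.
    apply/(vmax_ofP dw)/vmax_preim; move: ab; rewrite -dval_div_gt0 // => /(vmax_ofP dw).
    by case=> [->|nV]; [left|right => Vt; apply: nV; exact: ((et _).2 Vt)].
  have [l lP] := finite_orbit (aF x).
  pose tn := fix tn n : {rmorphism Om -> Om} := if n is m.+1 then t \o tn m else idfun.
  apply: (@no_chain (fun n => tn n x) l).
    move=> n; apply: lP; elim: n => [|n IH]; first exact: aut_over_id.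
    exact: (aut_over_comp tF IH).
  by elim=> [|n IH] //=; exact: mono.
move=> aF sF es x; apply/le_anti; rewrite noinc //=.
have [t [tF sK tK]] := aut_over_inv aF sF.
rewrite -{1}(sK x); apply: noinc => // y.
by split=> Vy; [apply/es|move/es: Vy]; rewrite tK.
Qed.

Definition decomposition F : set {rmorphism Om -> Om} :=
  [set s | aut_over F s /\ forall x, w (s x) = w x].

Definition decomposition_field F : set Om :=
  [set x | forall s, decomposition F s -> s x = x].

Lemma decomposition_comp F s t :
  decomposition F s -> decomposition F t -> decomposition F (s \o t).
Proof. by move=> [sF ws] [tF wt]; split; [exact: aut_over_comp|move=> x /=; rewrite ws wt]. Qed.

Lemma decomposition_id F : decomposition F idfun. Proof. by []. Qed.

Lemma decomposition_sub F : decomposition F `<=` aut_over F. Proof. by move=> s []. Qed.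

Lemma decomposition_field_sf F : subfield (decomposition_field F).
Proof.
split; first by move=> s _; rewrite rmorph1.
- by move=> x y fx fy s ds; rewrite rmorphB fx // fy.
- by move=> x y fx fy s ds; rewrite fmorph_div fx // fy.
Qed.

Lemma decomposition_field_ge F : F `<=` decomposition_field F.
Proof. by move=> x Fx s [sF _]; exact: sF. Qed.

Lemma vring_of_conjugate F (H : oagType) (u : Om -> ext H) : subfield F -> algebraic_over F ->
  dval u -> equiv_on F u w ->
  exists2 s, aut_over F s & forall x, (Fin 0 <= u x) = (Fin 0 <= w (s x)).
Proof.
move=> sF aF du e.
have [|s sA es] := vring_conjugate sF aF (vring_ofP du) (vring_ofP dw).
  by move=> x Fx; rewrite /vring_of /= e.
by exists s => // x; apply/idP/idP; [move/es|move=> h; apply/es].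
Qed.

(** The orbit polynomial of x under the decomposition group has coefficients in the decomposition
    field, so s maps x into this orbit. That t depends on x does no harm when only values are
    compared. *)
Lemma decomposition_closed F s : algebraic_over F -> aut_over (decomposition_field F) s ->
  forall x, exists2 t, decomposition F t & t x = s x.
Proof.
move=> aF sA x; have [l ul lP] := exact_orbit x aF (@decomposition_sub F).
pose g := \prod_(z <- l) ('X - z%:P).
have sg : map_poly s g = g.
  apply/polyP => i; rewrite coef_map /=; apply: sA => t dt.
  have tg := orbit_poly (@decomposition_comp F) ul lP dt.
  by have := congr1 (fun p : {poly Om} => p`_i) tg; rewrite coef_map.
have : root g (s x).
  rewrite -sg /root horner_map fmorph_eq0 -/(root g x) root_prod_XsubC.
  by apply/lP; exists idfun => //; exact: decomposition_id.
by rewrite root_prod_XsubC => /lP.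
Qed.

Lemma valuation_on_total (L : set Om) (H : oagType) (u : Om -> ext H) :
  algebraic_over L -> valuation_on (alg_closure_in L) u -> dval u.
Proof. by move=> aL uv; apply/valuationP => x y _ _; apply: uv; exact: aL. Qed.

(** Another extension u is conjugate to w by an automorphism over the decomposition field, and such
    an automorphism preserves w because it agrees at each point with an element of the decomposition
    group. *)
Lemma decomposition_field_henselian F : subfield F -> algebraic_over F ->
  henselian w (decomposition_field F).
Proof.
move=> sF aF G' u uv e x _; set Z := decomposition_field F in uv e.
have aZ : algebraic_over Z.
  exact: algebraic_overS (@decomposition_field_ge F) aF.
have sZ : subfield Z by exact: decomposition_field_sf.
have [s sZA es] := vring_of_conjugate sZ aZ (valuation_on_total aZ uv) e.
have [t [_ wt] tx] := decomposition_closed aF sZA x.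
by rewrite es -tx wt.
Qed.

(** A factor zX - y is normalised by -y if w y < w z, and becomes congruent to 1; it is normalised
    by z if w y > w z, and becomes congruent to X. So k counts the y of value greater than w z. *)
Lemma poly_congr_one (z : Om) (r : seq Om) : z != 0 -> (forall y, y \in r -> w y != w z) ->
  exists C k, C != 0 /\
    forall i, Fin 0 < w ((C *: \prod_(y <- r) (z *: 'X - y%:P) - 'X^k)`_i).
Proof.
move=> z0; elim: r => [|y r IH] yP.
  exists 1, 0; split=> [|i]; first exact: oner_neq0.
  by rewrite big_nil scale1r expr0 subrr coef0 (dval0 dw).
have [|C [k [C0 small]]] := IH; first by move=> x xr; apply: yP; rewrite inE xr orbT.
set P := \prod_(_ <- _) _ in small; set h := C *: P in small.
have int i : Fin 0 <= w h`_i.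
  rewrite -[h](subrK 'X^k) coefD (dval_leD dw) //; first exact: ltW.
  by rewrite coefXn; case: eqP => _ /=; rewrite ?(dval1 dw) ?(dval0 dw).
have intX i : Fin 0 <= w ('X * h)`_i.
  by rewrite coefXM; case: eqP => _ //; rewrite (dval0 dw).
have coefP c i : (c *: \prod_(x <- y :: r) (z *: 'X - x%:P))`_i =
    c * (z * ('X * P)`_i - y * P`_i).
  by rewrite coefZ big_cons mulrBl -scalerAl coefB coefZ coefCM.
have coefh i : h`_i = C * P`_i by rewrite coefZ.
have coefXh i : ('X * h)`_i = C * ('X * P)`_i by rewrite -scalerAr coefZ.
have [lt|gt|e] := ltgtP (w y) (w z); last by have := yP y; rewrite inE eqxx e eqxx => /(_ isT).
  have y0 : y != 0 by rewrite -(dval_eqInf dw) (lt_neqInf lt).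
  exists (C / - y), k; split=> [|i]; first by rewrite mulf_neq0 ?invr_eq0 ?oppr_eq0.
  have -> : ((C / - y) *: \prod_(x <- y :: r) (z *: 'X - x%:P) - 'X^k)`_i =
      (h - 'X^k)`_i - (z / y) * ('X * h)`_i.
    by rewrite !coefB coefP coefXh coefh; field; rewrite oppr_eq0 y0.
  by rewrite (dval_ltB dw) // dvalM // ext_addr_gt0 ?dval_div_gt0.
exists (C / z), k.+1; split=> [|i]; first by rewrite mulf_neq0 ?invr_eq0.
have -> : ((C / z) *: \prod_(x <- y :: r) (z *: 'X - x%:P) - 'X^(k.+1))`_i =
    ('X * (h - 'X^k))`_i - (y / z) * h`_i.
  by rewrite exprS mulrBr !coefB coefP coefXh coefh; field.
rewrite (dval_ltB dw) //; last by rewrite dvalM // ext_addr_gt0 ?dval_div_gt0.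
by rewrite coefXM; case: eqP => _ //; rewrite (dval0 dw).
Qed.

Lemma coef_prod_scaleX (z : Om) (r : seq Om) i :
  (\prod_(y <- r) (z *: 'X - y%:P))`_i = (\prod_(y <- r) ('X - y%:P))`_i * z ^+ i.
Proof.
elim: r i => [|y r IH] i; first by rewrite !big_nil coef1; case: i => [|i]; rewrite ?mulr1 ?mul0r.
rewrite !big_cons !mulrBl -scalerAl !coefB coefZ !coefCM !coefXM !IH mulrBl.
case: i => [|i] /=; first by rewrite mulr0 mul0r !expr0 !mulr1.
by rewrite exprS !mulrA [z * _]mulrC.
Qed.

(* There is a y congruent to 1 whose conjugates by automorphisms moving x have
   positive value. For suitable n, the element z = y^n x has the leading term
   of x, and no other conjugate of z has the value of z. Its leading term is
   then minus that of the quotient of two successive coefficients of its orbit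
   polynomial. *)
Lemma decomposition_immediate F x : subfield F -> algebraic_over F -> x != 0 ->
  decomposition_field F x ->
  exists f, (forall s, aut_over F s -> s f = f) /\ sim w x f.
Proof.
move=> sF aF x0 fx; pose M := field_gen (F `|` [set x]).
have sM : subfield M by exact: field_gen_subfield.
have FM : F `<=` M by move=> y Fy; apply: field_gen_ge; left.
have Mx : M x by apply: field_gen_ge; right.
have sgM s t : aut_over F s -> aut_over F t -> s x = t x -> forall y, M y -> s y = t y.
  move=> sA tA e y; move: y; apply: field_gen_le; first exact: subfield_eq.
  by move=> y [Fy|->//] /=; rewrite sA // tA.
have [l ul lP] := exact_orbit x aF (@subset_refl _ (aut_over F)).
pose I := {i : 'I_(size l) | nth 0 l i != x}.
have /choice[sg sgP] (i : I) : exists s, aut_over F s /\ s x = nth 0 l (val i).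
  by have /lP[s sA e] := mem_nth 0 (ltn_ord (val i)); exists s.
pose V := vring_of w; have vV : vring V by exact: vring_ofP.
have vsg i := vring_preim (sg i) vV.
have /choice[t tP] i : exists t : Om, [/\ M t, vmax V t & ~ (sg i @^-1` V) t].
  apply: (vring_separate vV (vsg i) sF sM FM aF) => [y Fy|e].
    by rewrite /= (sgP i).1.
  (* If the two rings agreed on M, [sg i] could be composed with an automorphism over M to an
     element of the decomposition group that moves x. *)
  have aM := algebraic_overS FM aF.
  have [s sA es] := vring_conjugate sM aM vV (vsg i) e.
  have sFA := aut_overS FM sA; have [sgF sgx] := sgP i.
  have dc : decomposition F (sg i \o s).
    split; first exact: aut_over_comp.
    by apply: (@dval_aut F) => //; exact: aut_over_comp.
  have := fx _ dc; rewrite /= sA // sgx => e'.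
  by case/negP: (valP i); rewrite e'.
have [y [My yV ymax]] := vring_approx vV vsg sM tP.
have y1 : sim w 1 y by rewrite /sim (dval1 dw) -opprB (dvalN dw); exact/vmax_ofP.
have y0 : y != 0 by exact: sim_neq0 (sim_sym dw y1).
have /choice[N NP] (i : I) : exists N, forall n, (N <= n)%N -> w (sg i (y ^+ n * x)) != w x.
  have pos : Fin 0 < w (sg i y) by apply/(vmax_ofP dw)/vmax_preim; exact: ymax.
  (* Since w (sg i y) > 0, the values of these conjugates increase strictly with n, so that equality
     with w x occurs at most once. *)
  have [[n0 e]|no] := pselect (exists n, w (sg i (y ^+ n * x)) = w x); last first.
    by exists 0 => n _; apply/eqP => e; apply: no; exists n.
  exists n0.+1 => n lt; rewrite -e gt_eqF // -(subnKC lt) addSnnS exprD mulrAC.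
  rewrite [X in _ < w X]rmorphM dvalM // addrC ext_lt_addl //.
    by rewrite dval_neqInf // fmorph_eq0 mulf_neq0 ?expf_neq0.
  rewrite exprS rmorphM rmorphXn dvalM // dvalX // ext_addr_gt0 //.
  elim: (n - n0.+1)%N => [|m IH]; first by rewrite mulr0n.
  by rewrite mulrS ext_addr_ge0 // ltW.
pose n := \max_i N i; pose z := y ^+ n * x.
have xz : sim w x z.
  rewrite -[x]mul1r; apply: simM => //; last exact: sim_refl.
  by rewrite -(expr1n _ n); exact: sim_exp.
have z0 : z != 0 by exact: sim_neq0 (sim_sym dw xz).
have Mz : M z by apply: (sfM sM) => //; exact: (sfX sM).
have [r ur rP] := exact_orbit z aF (@subset_refl _ (aut_over F)).
have zr : z \in r by apply/rP; exists idfun.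
have rval c : c \in rem z r -> w c != w z.
  rewrite mem_rem_uniq // !inE => /andP[cz /rP[s sA e]].
  have sl : s x \in l by apply/lP; exists s.
  have [sx|sx] := eqVneq (s x) x.
    by case/eqP: cz; rewrite -e (sgM s idfun).
  have il : (index (s x) l < size l)%N by rewrite index_mem.
  have ix : nth 0 l (Ordinal il) != x by rewrite /= nth_index.
  have [sgF sgx] := sgP (exist _ (Ordinal il) ix).
  have {}e : sg (exist _ (Ordinal il) ix) z = c.
    by rewrite -e; apply: sgM => //; rewrite sgx /= nth_index.
  by rewrite -e (sim_val dw xz) NP // /n leq_bigmax.
have [C [k [C0 small]]] := poly_congr_one z0 rval.
pose g := \prod_(c <- r) ('X - c%:P).
have gfix s i : aut_over F s -> s g`_i = g`_i.
  move=> sA; have sg' := orbit_poly (@aut_over_comp _ F) ur rP sA.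
  by have := congr1 (fun p : {poly Om} => p`_i) sg'; rewrite coef_map.
pose h := C *: \prod_(c <- rem z r) (z *: 'X - c%:P).
have gh i : C * (g`_i * z ^+ i) = z * (('X - 1) * h)`_i.
  rewrite -coef_prod_scaleX -coefZ (perm_big _ (perm_to_rem zr)) big_cons /=.
  have -> : z *: 'X - z%:P = z *: ('X - 1) by rewrite scalerBr alg_polyC.
  by rewrite -scalerAl -coefZ !scalerA /h -scalerAr !scalerA mulrC.
(* As h is congruent to ['X^k], the coefficients of [('X - 1) * h] at k + 1 and k are congruent to 1
   and -1; [gh] relates them to those of the orbit polynomial. *)
have hk1 : sim w 1 ((('X - 1) * h)`_k.+1).
  have -> : (('X - 1) * h)`_k.+1 = 1 + (h - 'X^k)`_k - (h - 'X^k)`_k.+1.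
    rewrite mulrBl mul1r !coefB coefXM /= !coefXn eqxx gtn_eqF // mulr1n mulr0n; ring.
  rewrite /sim (dval1 dw) opprB addrCA opprD addNKr.
  by rewrite (dval_ltB dw).
have hk : sim w (-1) ((('X - 1) * h)`_k).
  have -> : (('X - 1) * h)`_k = - 1 + ('X * (h - 'X^k))`_k - (h - 'X^k)`_k.
    rewrite mulrBl mul1r mulrBr -exprS !coefB !coefXn eqxx ltn_eqF // mulr1n mulr0n; ring.
  rewrite /sim (dvalN dw) (dval1 dw) opprB addrCA opprD addNKr.
  rewrite (dval_ltB dw) // coefXM; case: eqP => _ //; by rewrite (dval0 dw).
have hk10 := sim_neq0 dw (sim_sym dw hk1); set b := _`_k.+1 in hk1 hk10.
set a := _`_k in hk.
have g1 : g`_k.+1 = z * b / (C * z ^+ k.+1).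
  by rewrite /b -gh; field; rewrite ?C0 ?z0 ?expf_neq0.
have g2 : g`_k = z * a / (C * z ^+ k).
  by rewrite /a -gh; field; rewrite ?C0 ?z0 ?expf_neq0.
exists (- (g`_k / g`_k.+1)); split=> [s sA|]; first by rewrite rmorphN fmorph_div !gfix.
apply: sim_trans xz _ => //.
have -> : - (g`_k / g`_k.+1) = z * (- a / b).
  by rewrite g1 g2 exprS; field; rewrite ?hk10 ?C0 ?z0 ?expf_neq0.
rewrite -{1}[z]mulr1; apply: simM => //; first exact: sim_refl.
have hk' : sim w 1 (- a).
  have e : 1 - - a = - (-1 - a) by rewrite opprB !opprK addrC.
  by rewrite /sim e (dvalN dw) -(dvalN dw 1); exact: hk.
apply: (sim_trans dw hk').
have c0 : - a / b != 0.
  by apply: mulf_neq0; [exact: (sim_neq0 dw (sim_sym dw hk'))|rewrite invr_eq0].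
rewrite -{1}[- a](divfK hk10) -[X in sim w _ X]mulr1.
by apply: simM => //; [exact: sim_refl|exact: sim_sym].
Qed.

End Decomposition.

(** * Automorphisms and leading terms *)

Section Gauss.
Variables (R : idomainType) (G : oagType) (W : R -> ext G) (gam : G).
Hypothesis dW : dval W.
Implicit Types (p q : {poly R}).

Definition gauss p : ext G := \big[Num.min/Inf]_(i < size p) (W p`_i + Fin (gam *+ i)).

Lemma gauss_ge c p : (forall i, c <= W p`_i + Fin (gam *+ i)) -> c <= gauss p.
Proof. by move=> cp; rewrite /gauss; elim/big_rec: _ => // i x _ cx; rewrite le_min cp. Qed.

Lemma gauss_le p i : gauss p <= W p`_i + Fin (gam *+ i).
Proof.
have [lt|le] := ltnP i (size p); last by rewrite nth_default // dval0.
rewrite /gauss (bigD1 (Ordinal lt)) //= ge_min lexx //.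
Qed.

Lemma gauss_att p : p != 0 -> exists i, [/\ gauss p = W p`_i + Fin (gam *+ i),
  W p`_i != Inf & forall j, (j < i)%N -> gauss p < W p`_j + Fin (gam *+ j)].
Proof.
move=> p0; have ex : exists i, gauss p == W p`_i + Fin (gam *+ i).
  have : gauss p = Inf \/ exists i, gauss p = W p`_i + Fin (gam *+ i).
    rewrite /gauss; elim/big_rec: _ => [|i x _ IH]; first by left.
    by right; case: leP => _; [exists i|case: IH => [->|//]; exists (size p); rewrite nth_default // dval0].
  by case=> [e|[i e]]; [exists (size p); rewrite e nth_default // dval0|exists i; rewrite e].
exists (ex_minn ex); case: ex_minnP => i /eqP e mini; split=> // [|j ji].
  have := gauss_le p (size p).-1; rewrite e -lead_coefE.
  apply: contraTneq => ->; rewrite addInf Inf_le add_eqInf orbF dval_eqInf //.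
  by rewrite lead_coef_eq0.
rewrite lt_neqAle gauss_le andbT; apply: contraTneq ji => ej.
by rewrite -leqNgt mini ?ej.
Qed.

Lemma dval_sum_shift c g (I : Type) (r : seq I) (P : pred I) (E : I -> R) :
  (forall i, P i -> c <= W (E i) + Fin g) -> c <= W (\sum_(i <- r | P i) E i) + Fin g.
Proof.
move=> ge; elim/big_rec: _ => [|i x Pi cx]; first by rewrite dval0.
have [le|lt] := leP (W (E i)) (W x).
  by apply: le_trans (ge i Pi) _; apply: ext_leD2r; apply: dval_leD.
by apply: le_trans cx _; apply: ext_leD2r; apply: dval_leD => //; exact: ltW.
Qed.

Lemma dval_sum_shift_lt c g (I : Type) (r : seq I) (P : pred I) (E : I -> R) : c != Inf ->
  (forall i, P i -> c < W (E i) + Fin g) -> c < W (\sum_(i <- r | P i) E i) + Fin g.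
Proof.
move=> cI ge; elim/big_rec: _ => [|i x Pi cx]; first by rewrite dval0 // lt_Inf.
have [le|lt] := leP (W (E i)) (W x).
  by apply: lt_le_trans (ge i Pi) _; apply: ext_leD2r; apply: dval_leD.
by apply: lt_le_trans cx _; apply: ext_leD2r; apply: dval_leD => //; exact: ltW.
Qed.

(** If i and j are the least indices at which p and q attain their values, then p_i q_j is the only
    term of least value in the coefficient of p q at i + j. *)
Lemma gauss_dval : dval gauss.
Proof.
have g0 : gauss 0 = Inf by rewrite /gauss size_poly0 big_ord0.
have gI p : p != 0 -> gauss p != Inf.
  by move=> /gauss_att[i [-> pi _]]; rewrite add_eqInf negb_or pi.
split.
- by move=> p; have [->|/[dup] p0 /gI/negbTE //] := eqVneq p 0; rewrite g0 eqxx.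
- move=> p q; have [->|p0] := eqVneq p 0; first by rewrite mul0r g0.
  have [->|q0] := eqVneq q 0; first by rewrite mulr0 g0 addxInf.
  have shift (a b : R) j k : (j <= k)%N -> W (a * b) + Fin (gam *+ k) =
      (W a + Fin (gam *+ j)) + (W b + Fin (gam *+ (k - j))).
    by move=> jk; rewrite dvalM // -{1}(subnKC jk) mulrnDr FinD addrACA.
  apply/le_anti/andP; split; last first.
    apply: gauss_ge => k; rewrite coefM; apply: dval_sum_shift => i _.
    rewrite (shift _ _ i); last by rewrite -ltnS.
    by apply: ext_leD; exact: gauss_le.
  have [i [ei pi mi]] := gauss_att p0; have [j [ej qj mj]] := gauss_att q0.
  apply: le_trans (gauss_le _ (i + j)) _; rewrite coefM.
  have ilt : (i < (i + j).+1)%N by rewrite ltnS leq_addr.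
  rewrite (bigD1 (Ordinal ilt)) //= addKn.
  have e : W (p`_i * q`_j) + Fin (gam *+ (i + j)) = gauss p + gauss q.
    by rewrite (shift _ _ i) ?leq_addr // addKn -ei -ej.
  have cI : gauss p + gauss q != Inf by rewrite add_eqInf negb_or !gI.
  rewrite dval_eqD // ?e // -(ext_ltD2r _ _ (_ : Fin (gam *+ (i + j)) != Inf)) // e.
  apply: dval_sum_shift_lt => // k; rewrite -val_eqE /= => ki.
  have kle : (k <= i + j)%N by rewrite -ltnS.
  rewrite (shift _ _ _ _ kle); have [lt|gt|ke] := ltngtP k i.
  - by apply: ext_lt_leD; rewrite ?mi ?gauss_le ?gI.
  - rewrite [X in X < _]addrC [X in _ < X]addrC.
    apply: ext_lt_leD; rewrite ?gauss_le ?gI //; apply: mj.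
    by rewrite ltn_subLR // ltn_add2r.
  - by rewrite ke eqxx in ki.
- move=> p q; apply: gauss_ge => i; rewrite coefD.
  have [le|lt] := leP (W p`_i) (W q`_i).
    by rewrite ge_min; apply/orP; left; apply: le_trans (gauss_le p i) _;
      apply: ext_leD2r; apply: dval_leD.
  rewrite ge_min; apply/orP; right; apply: le_trans (gauss_le q i) _.
  by apply: ext_leD2r; apply: dval_leD => //; exact: ltW.
Qed.

End Gauss.

(* The last condition says that mu fixes the leading terms of the invariants of
   the group of isometries indexed by D. *)
Definition rv_system (R : idomainType) (G : oagType) (W : R -> ext G) (S : Type)
    (D : set S) (rho : S -> {rmorphism R -> R}) (mu : {rmorphism R -> R}) :=
  [/\ dval W, (forall s, D s -> forall x, W (rho s x) = W x) /\ (forall x, W (mu x) = W x),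
    exists2 s, D s & forall x, rho s x = x,
    forall s t, D s -> D t -> exists2 r, D r & forall x, rho r x = rho s (rho t x)
  & forall c, c != 0 -> (forall s, D s -> rho s c = c) -> W c < W (mu c - c)].

Section RV.
Variables (G : oagType) (S : Type) (D : set S).

(* The orbit polynomial g of x satisfies g(mu x) = (g - mu(g))(mu x), which has
   value greater than deg(g) W(x); so one of the factors of g(mu x) has value
   greater than W(x). *)
Lemma rv_one (R : idomainType) (W : R -> ext G) rho mu x (l : seq R) :
  rv_system W D rho mu -> x != 0 -> (forall s, D s -> rho s x \in l) ->
  exists2 s, D s & W x < W (mu x - rho s x).
Proof.
move=> [dW [Wr Wm] [s0 Ds0 rs0] comp inv] x0 xl.
pose r := undup [seq y <- l | `[< exists2 s, D s & rho s x = y >]].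
have rP y : y \in r <-> exists2 s, D s & rho s x = y.
  rewrite mem_undup mem_filter; split=> [/andP[/asboolP]//|ex].
  by apply/andP; split; [exact/asboolP|case: ex => s Ds <-; exact: xl].
pose g := \prod_(y <- r) ('X - y%:P).
have inj s : D s -> injective (rho s).
  move=> Ds y z e; apply/eqP; rewrite -subr_eq0 -(dval_eqInf dW) -(Wr s Ds) rmorphB e subrr.
  by rewrite dval0.
have gfix s : D s -> map_poly (rho s) g = g.
  move=> Ds; have sl y : y \in r -> rho s y \in r.
    move=> /rP[t Dt <-]; have [u Du e] := comp _ _ Ds Dt.
    by apply/rP; exists u.
  rewrite rmorph_prod /=.
  under eq_bigr do rewrite rmorphB /= map_polyX map_polyC /=.
  rewrite -(big_map (rho s) predT (fun y => 'X - y%:P)); apply: perm_big.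
  have us : uniq (map (rho s) r) by rewrite map_inj_uniq ?undup_uniq //; exact: inj.
  have sub : {subset map (rho s) r <= r} by move=> _ /mapP[y yl ->]; exact: sl.
  have [|_ e] := uniq_min_size us sub; first by rewrite size_map.
  by apply: uniq_perm => //; exact: undup_uniq.
have Wx y : y \in r -> W y = W x by move=> /rP[s Ds <-]; exact: Wr.
have gx : g.[x] = 0 by apply/rootP; rewrite root_prod_XsubC; apply/rP; exists s0.
(* This coefficient is, up to sign, a sum of products of size r - i elements of value W x; the bound
   is written additively to avoid subtraction. *)
have Wg i : W x *+ size r <= W g`_i + W x *+ i.
  rewrite /g; elim: r {rP g gfix gx} Wx i => [|y r IH] Wx i.
    by rewrite big_nil mulr0n coef1; case: i => [|i] /=; rewrite ?(dval1 dW) ?(dval0 dW) ?mulr0n ?addr0.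
  have {}IH := IH (fun z zr => Wx z (@mem_behead _ (y :: r) z zr)).
  have Wy : W y = W x by apply: Wx; rewrite inE eqxx.
  rewrite big_cons mulrBl coefB coefXM coefCM /=.
  have le2 : W x *+ (size r).+1 <= W (y * (\prod_(z <- r) ('X - z%:P))`_i) + W x *+ i.
    by rewrite dvalM // Wy mulrS -addrA addrC [leRHS]addrC ext_leD2r.
  case: i le2 => [|i] le2 /=; first by rewrite sub0r dvalN.
  have le1 : W x *+ (size r).+1 <= W ((\prod_(z <- r) ('X - z%:P))`_i) + W x *+ i.+1.
    by rewrite !mulrS addrCA addrC [leRHS]addrC ext_leD2r.
  set a := _`_i in le1 *; set b := y * _ in le2 *.
  have [le|lt] := leP (W a) (W b).
    by apply: le_trans le1 _; apply: ext_leD2r; apply: dval_leB.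
  by apply: le_trans le2 _; apply: ext_leD2r; apply: dval_leB => //; exact: ltW.
have xI : W x *+ size r != Inf.
  have [->|sr] := posnP (size r); first by rewrite mulr0n.
  by rewrite ext_muln_eqInf // dval_neqInf.
have big : W x *+ size r < W g.[mu x].
  have -> : g.[mu x] = \sum_(i < size g) (g`_i - mu g`_i) * mu x ^+ i.
    have : (map_poly mu g).[mu x] = 0 by rewrite horner_map gx rmorph0.
    rewrite (horner_coef g) (horner_coef (map_poly mu g)).
    rewrite (size_map_inj_poly _ (rmorph0 mu)); last first.
      move=> y z e; apply/eqP; rewrite -subr_eq0 -(dval_eqInf dW) -Wm rmorphB e subrr.
      by rewrite dval0.
    move=> e; rewrite -[LHS]subr0 -[X in _ - X]e -sumrB; apply: eq_bigr => i _.
    by rewrite coef_map mulrBl.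
  apply: dval_sum_lt => // i _; rewrite dvalM // dvalX // Wm.
  have [->|gi] := eqVneq g`_i 0; first by rewrite rmorph0 subrr dval0 // addInf lt_Inf.
  apply: le_lt_trans (Wg i) _; rewrite ext_ltD2r; last first.
    have [->|i0] := posnP i; first by rewrite mulr0n.
    by rewrite ext_muln_eqInf // dval_neqInf.
  rewrite -opprB dvalN //; apply: inv => // s Ds.
  by have := congr1 (fun p : {poly R} => p`_i) (gfix s Ds); rewrite coef_map.
apply: contrapT => no; have small y : y \in r -> W (mu x - y) <= W x.
  by move=> /rP[s Ds <-]; rewrite leNgt; apply/negP => lt; apply: no; exists s.
suff : W g.[mu x] <= W x *+ size r by rewrite leNgt big.
rewrite /g horner_prod; elim: r {rP g gfix gx Wg Wx big xI} small => [|y r IH] small.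
  by rewrite big_nil dval1.
rewrite big_cons dvalM //= mulrS ext_leD //.
  by rewrite hornerXsubC small // inE eqxx.
by apply: IH => z zr; apply: small; rewrite inE zr orbT.
Qed.

(** Invariant polynomials have invariant coefficients, so the condition on leading terms can be
    checked at a coefficient where mu(c) - c attains its Gauss value. *)
Lemma rv_system_poly (R : idomainType) (W : R -> ext G) rho mu gam :
  rv_system W D rho mu ->
  rv_system (gauss W gam) D (fun s => map_poly (rho s) : {rmorphism {poly R} -> {poly R}})
    (map_poly mu).
Proof.
move=> [dW [Wr Wm] [s0 Ds0 rs0] comp inv].
have isom (f : {rmorphism R -> R}) : (forall x, W (f x) = W x) ->
    forall p, gauss W gam (map_poly f p) = gauss W gam p.
  move=> Wf p; apply/le_anti/andP; split; apply: gauss_ge => // i.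
    by rewrite -Wf -coef_map gauss_le.
  by rewrite coef_map /= Wf gauss_le.
split.
- exact: gauss_dval.
- by split=> [s Ds|] p; apply: isom => //; exact: Wr.
- by exists s0 => // p; apply/polyP => i; rewrite coef_map /= rs0.
- move=> s t Ds Dt; have [r Dr e] := comp s t Ds Dt; exists r => // p.
  by apply/polyP => i; rewrite !coef_map /= e.
- move=> c c0 fc; have fci i s : D s -> rho s c`_i = c`_i.
    by move=> Ds; have := congr1 (fun p : {poly R} => p`_i) (fc s Ds); rewrite coef_map.
  have [mc|mc] := eqVneq (map_poly mu c - c) 0.
    by rewrite mc (dval0 (gauss_dval gam dW)) lt_Inf dval_neqInf //; exact: gauss_dval.
  have [i [-> nI _]] := gauss_att gam dW mc.
  apply: le_lt_trans (gauss_le gam dW c i) _; rewrite ext_ltD2r // coefB coef_map /=.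
  apply: inv => [|s Ds]; last exact: fci.
  apply: contraNneq nI => ci; rewrite coefB coef_map /= ci rmorph0 subrr.
  by rewrite (dval0 dW).
Qed.

(* Two elements x, y are merged into the polynomial x + yT, for a Gauss
   valuation that gives both monomials the same value. *)
Lemma rv_many n : forall (R : idomainType) (W : R -> ext G) rho mu (xs : seq R),
  rv_system W D rho mu -> size xs = n.+1 -> (forall x, x \in xs -> x != 0) ->
  (forall x, x \in xs -> exists l : seq R, forall s, D s -> rho s x \in l) ->
  exists2 s, D s & forall x, x \in xs -> W x < W (mu x - rho s x).
Proof.
elim: n => [|n IH] R W rho mu xs sys.
  case: xs => [|x [|//]] // _ x0 xl; have [|l lP] := xl x; first by rewrite inE.
  have [|s Ds lt] := rv_one sys _ lP; first by apply: x0; rewrite inE.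
  by exists s => // y; rewrite inE => /eqP ->.
case: xs => [|x [|y r]] //= [sr] nz fin; have [dW _ _ _ _] := sys.
have x0 : x != 0 by apply: nz; rewrite inE eqxx.
have y0 : y != 0 by apply: nz; rewrite !inE eqxx orbT.
have [gx ex] := neqInfP (dval_neqInf dW x0).
have [gy ey] := neqInfP (dval_neqInf dW y0).
pose gam := gx - gy; pose z := x%:P + y *: 'X.
have cz i : z`_i = if i is j.+1 then (if j is 0 then y else 0) else x.
  by rewrite coefD coefC coefZ coefX; case: i => [|[|i]] /=; rewrite ?mulr0 ?addr0 ?mulr1 ?add0r.
have gC c : gauss W gam c%:P = W c.
  apply/le_anti/andP; split.
    by have := gauss_le gam dW c%:P 0; rewrite coefC eqxx mulr0n [_ + Fin 0]addrC -[Fin 0 + _]/(0 + W c) add0r.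
  apply: gauss_ge => // i; rewrite coefC; case: eqP => [->|_]; last by rewrite (dval0 dW).
  by rewrite mulr0n [_ + Fin 0]addrC -[Fin 0 + _]/(0 + W c) add0r.
have Wyx : W y + Fin gam = W x by rewrite ex ey -FinD /gam addrCA subrr addr0.
have gz : gauss W gam z = W x.
  apply/le_anti/andP; split.
    by have := gauss_le gam dW z 0; rewrite cz mulr0n [_ + Fin 0]addrC -[Fin 0 + _]/(0 + W x) add0r.
  apply: gauss_ge => // i; rewrite cz; case: i => [|[|i]]; last by rewrite (dval0 dW).
    by rewrite mulr0n [_ + Fin 0]addrC -[Fin 0 + _]/(0 + W x) add0r.
  by rewrite mulr1n Wyx.
have mapz (f : {rmorphism R -> R}) : map_poly f z = (f x)%:P + f y *: 'X.
  by rewrite rmorphD /= map_polyC linearZ /= map_polyX.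
have [|||s Ds sP] := IH _ _ _ _ (z :: map polyC r) (rv_system_poly gam sys).
- by rewrite /= size_map sr.
- move=> p; rewrite inE => /orP[/eqP ->|/mapP[c cr ->]].
    by apply: contraNneq x0 => z0; have /= := cz 0; rewrite z0 coef0 => <-.
  by rewrite polyC_eq0 nz // !inE cr !orbT.
- move=> p; rewrite inE => /orP[/eqP ->|/mapP[c cr ->]].
    have [|lx lxP] := fin x; first by rewrite inE eqxx.
    have [|ly lyP] := fin y; first by rewrite !inE eqxx orbT.
    exists [seq a%:P + b *: 'X | a <- lx, b <- ly] => s Ds /=.
    by rewrite mapz; apply: allpairs_f; [exact: lxP|exact: lyP].
  have [|l lP] := fin c; first by rewrite !inE cr !orbT.
  by exists (map polyC l) => s Ds; rewrite /= map_polyC; apply: map_f; exact: lP.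
exists s => // c; rewrite !inE => /or3P[/eqP ->|/eqP ->|cr].
- have := sP z; rewrite inE eqxx gz => /(_ isT)/lt_le_trans.
  move=> /(_ _ (gauss_le gam dW _ 0)); rewrite /= !mapz coefB !coefD !coefC !coefZ !coefX /= !mulr0 !addr0.
  by [].
- have := sP z; rewrite inE eqxx gz => /(_ isT)/lt_le_trans.
  move=> /(_ _ (gauss_le gam dW _ 1)); rewrite /= !mapz coefB !coefD !coefC !coefZ !coefX /= !mulr1 !add0r.
  by rewrite ?mulr1n -Wyx ext_ltD2r.
- have := sP c%:P; rewrite inE map_f ?orbT // => /(_ isT).
  by rewrite /= !map_polyC -polyCB !gC.
Qed.

End RV.

(** * Factoring automorphisms through the ramification group *)

Section RamificationFactor.
Variables (Om : closedFieldType) (G : oagType) (w : Om -> ext G).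
Hypothesis dw : dval w.
Implicit Types (F E : set Om) (s t : {rmorphism Om -> Om}) (x y z : Om).

Lemma sim_aut s x y : (forall z, w (s z) = w z) -> sim w x y -> sim w (s x) (s y).
Proof. by move=> ws; rewrite /sim -rmorphB !ws. Qed.

(** x has the leading term of some f fixed by all automorphisms over E. A power f^q lies in E, where
    s acts trivially on leading terms, and q-th roots preserve equality of leading terms. *)
Lemma decomposition_sim E s x : subfield E -> algebraic_over E ->
  (forall y, w (s y) = w y) -> (forall y, E y -> y != 0 -> sim w y (s y)) ->
  decomposition_field w E x -> x != 0 -> sim w x (s x).
Proof.
move=> sE aE ws sE' dx x0.
have [f [ff xf]] := decomposition_immediate dw sE aE x0 dx.
have [q qp Ef] := fixed_power sE aE ff.
have f0 : f != 0 by exact: (sim_neq0 dw (sim_sym dw xf)).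
have sf : sim w f (s f).
  by apply: (sim_pchar_exp dw qp); rewrite -rmorphXn; apply: sE'; rewrite ?expf_neq0.
by apply: (sim_trans dw xf); apply: (sim_trans dw sf); apply/(sim_sym dw)/sim_aut.
Qed.

(** [rv_many], for the decomposition group of E, handles finite sets, and compactness gives one g
    over E such that g x and s x have the same leading term for all nonzero x. Then h is g^-1 s. *)
Theorem ramification_factor F E s : subfield F -> subfield E -> F `<=` E ->
  algebraic_over F -> decomposition w F s ->
  (forall y, E y -> y != 0 -> sim w y (s y)) ->
  exists g h, [/\ aut_over E g, aut_over F h, forall x, s x = g (h x)
    & forall x, x != 0 -> sim w x (h x)].
Proof.
move=> sF sE FE aF [sFA ws] simE; have aE := algebraic_overS FE aF.
have sys : rv_system w (decomposition w E) id s.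
  split=> //.
  - by split=> // t [].
  - by exists idfun => //; exact: decomposition_id.
  - by move=> t r dt dr; exists (t \o r) => //; exact: decomposition_comp.
  - move=> c c0 fc; have := decomposition_sim sE aE ws simE fc c0.
    by rewrite /sim -opprB dvalN.
(* The isometry condition is carried through the limit, so that leading terms can be compared after
   applying g^-1. *)
have [g gE gP] : exists2 g, aut_over E g &
    forall x, w (g x) = w x /\ (x != 0 -> w x < w (s x - g x)).
  apply: (aut_compact (Q := fun x y => w y = w x /\ (x != 0 -> w x < w (s x - y)))) => // S.
  pose S' := [seq x <- S | x != 0].
  have [e|n0] := posnP (size S').
    exists idfun => // x xS; split=> // x0.
    have : x \in S' by rewrite mem_filter x0.
    by rewrite (size0nil e).
  have [||t [tE wt] lt] := rv_many sys (esym (prednK n0)).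
  - by move=> x; rewrite mem_filter => /andP[].
  - move=> x _; have [l lP] := finite_orbit (aE x).
    by exists l => t [tE _]; exact: lP.
  exists t => // x xS; split=> // x0; apply: lt; by rewrite mem_filter x0.
have [t [tE gK tK]] := aut_over_inv aE gE.
exists g, (t \o s); split=> //.
- by apply: aut_over_comp => //; exact: aut_overS tE.
- by move=> x /=; rewrite tK.
- move=> x x0; rewrite /sim /= -(gP (x - _)).1 rmorphB tK -opprB dvalN //.
  exact: (gP x).2.
Qed.

End RamificationFactor.

(** * Restricting homomorphisms to an algebraically closed subfield *)

Section Restriction.
Variables (Om : closedFieldType).
Implicit Types (S : set (Om * Om)) (x y : Om) (p : {poly Om}).

Lemma hg_horner S p x y : hom_graph S -> poly_graph S p p -> S (x, y) ->
  S (p.[x], p.[y]).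
Proof.
move=> hS pp xy; rewrite !horner_coef; apply: hg_sum => // i; apply: hgM => //.
elim: (i : nat) => [|n IH]; first by rewrite !expr0; exact: hg1.
by rewrite !exprS; apply: hgM.
Qed.

Lemma hom_graph_root S p x y : hom_graph S -> poly_graph S p p -> S (x, y) ->
  root p x -> root p y.
Proof.
move=> hS pp xy /rootP px; apply/rootP.
by have := hg_horner hS pp xy; rewrite px; case: hS => _ _ _; apply.
Qed.

Lemma rmorphism_graph (s : {rmorphism Om -> Om}) : hom_graph [set xy | xy.2 = s xy.1].
Proof.
split=> /=; first by rewrite rmorph1.
- by move=> x x' y y' -> ->; rewrite rmorphB.
- by move=> x x' y y' -> ->; rewrite fmorph_div.
- by move=> y ->; rewrite rmorph0.
Qed.

Variables (Kb : closedFieldType) (e : {rmorphism Kb -> Om}) (F : set Kb).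

Lemma image_root (p : {poly Kb}) y : p != 0 -> root (map_poly e p) y -> range e y.
Proof.
move=> p0; have [l ->] := closed_field_poly_normal p.
rewrite map_polyZ rootZ; last by rewrite fmorph_eq0 lead_coef_eq0.
rewrite rmorph_prod /=; under eq_bigr do rewrite rmorphB /= map_polyX map_polyC /=.
rewrite -(big_map e predT (fun z => 'X - z%:P)) root_prod_XsubC => /mapP[z _ ->].
by exists z.
Qed.

(** S sends e c to a root of a polynomial over e(F). Such a polynomial splits in e(Kb), so S maps
    e(Kb) into itself. *)
Lemma hom_graph_restrict S : algebraic_over F -> hom_graph S ->
  (forall c, F c -> S (e c, e c)) -> (forall c, hom_dom S (e c)) ->
  exists2 t : {rmorphism Kb -> Kb}, aut_over F t & forall c, S (e c, e (t c)).
Proof.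
move=> aF hS fS dS; have /choice[f fP] c : exists c', S (e c, e c').
  have [y ey] := dS c; have [p [p0 Fp pc]] := aF c.
  have [|c' _ ec'] := image_root (p := p) (y := y) p0; last by exists c'; rewrite ec'.
  apply: hom_graph_root ey _ => //; last by rewrite /root horner_map fmorph_eq0.
  by move=> i; rewrite coef_map /=; exact: fS.
have ei := fmorph_inj e.
have [|||t tf] := @build_rmorph _ _ f.
- by apply: ei; apply: (hg_fun hS (fP 1)); rewrite !rmorph1; exact: hg1.
- move=> x y; apply: ei; apply: (hg_fun hS (fP _)); rewrite !rmorphB.
  by apply: (hgB hS).
- move=> x y; apply: ei; apply: (hg_fun hS (fP _)); rewrite !rmorphM.
  by apply: (hgM hS).
exists t => [c Fc|c]; last by rewrite tf.
by rewrite tf; apply: ei; apply: (hg_fun hS (fP c)); exact: fS.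
Qed.

End Restriction.

(** * Degrees of simple extensions *)

Section Degree.
Variables (K : fieldType) (Kb : closedFieldType) (iK : {rmorphism K -> Kb}).
Implicit Types (L : set Kb).

Lemma range_subfield (A B : fieldType) (e : {rmorphism A -> B}) (F : set A) :
  subfield F -> subfield (e @` F).
Proof.
move=> sF; split; first by exists 1; [exact: sf1|rewrite rmorph1].
- by move=> _ _ [x Fx <-] [y Fy <-]; exists (x - y); [exact: sfB|rewrite rmorphB].
- by move=> _ _ [x Fx <-] [y Fy <-]; exists (x / y); [exact: sf_div|rewrite fmorph_div].
Qed.

Lemma setT_subfield (A : fieldType) : subfield [set: A]. Proof. by []. Qed.

Lemma simple_subfield (F : set Kb) c g : subfield F -> minpoly F c g ->
  subfield [set x | exists2 h, polyIn F h & x = h.[c]].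
Proof.
move=> sF mg; split.
- by exists 1; [apply: (polyInC sF); exact: sf1|rewrite hornerC].
- move=> _ _ [h Fh ->] [k Fk ->]; exists (h - k); first exact: polyInB.
  by rewrite hornerD hornerN.
- move=> _ _ [h Fh ->] [k Fk ->]; have [->|k0] := eqVneq k.[c] 0.
    by exists 0; [exact: polyIn0|rewrite invr0 mulr0 horner0].
  have [l Fl e] := minpoly_inv sF mg Fk k0.
  exists (h * l); first exact: polyInM.
  by rewrite hornerM; congr (_ * _); apply: (mulfI k0); rewrite e mulfV.
Qed.

Lemma adjoin_simple c g x : minpoly (range iK) c g -> adjoin iK [set c] x ->
  exists h, [/\ polyIn (range iK) h, (size h < size g)%N & x = h.[c]].
Proof.
have sK : subfield (range iK) by apply: range_subfield; exact: setT_subfield.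
move=> mg; have sS := simple_subfield sK mg.
have sub : (range iK `|` [set c]) `<=` [set x | exists2 h, polyIn (range iK) h & x = h.[c]].
  move=> y [Ky|->]; first by exists y%:P; [exact: polyInC|rewrite hornerC].
  by exists 'X; [exact: polyInX|rewrite hornerX].
move=> /(field_gen_le sS sub)[h Fh ->].
by have [r Fr [sr e]] := minpoly_rem sK mg Fh; exists r.
Qed.

(** Needed because [degree] selects the length of an arbitrary basis. *)
Lemma basis_le L n m (b : 'I_n -> Kb) (b' : 'I_m -> Kb) :
  is_basis iK L b -> is_basis iK L b' -> (n <= m)%N.
Proof.
move=> [bL bI] [b'L b'I].
have /choice[A AP] i : exists c : 'rV[K]_m, b i = \sum_k iK (c 0 k) * b' k.
  apply/b'L/bL; exists (delta_mx 0 i); rewrite (bigD1 i) //= mxE !eqxx rmorph1 mul1r.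
  by rewrite big1 ?addr0 // => k ki; rewrite mxE (negbTE ki) andbF rmorph0 mul0r.
pose M : 'M[K]_(n, m) := \matrix_(i, k) A i 0 k.
have : row_free M.
  apply: inj_row_free => v vM; apply: bI.
  transitivity (\sum_k iK ((v *m M) 0 k) * b' k); last first.
    by rewrite vM big1 // => k _; rewrite mxE rmorph0 mul0r.
  under eq_bigr do rewrite AP mulr_sumr.
  rewrite exchange_big; apply: eq_bigr => k _ /=.
  rewrite mxE rmorph_sum mulr_suml; apply: eq_bigr => i _.
  by rewrite mxE rmorphM mulrA.
by rewrite /row_free => /eqP <-; exact: rank_leq_col.
Qed.

Lemma degree_adjoin c g : minpoly (range iK) c g ->
  degree iK (adjoin iK [set c]) = (size g).-1.
Proof.
move=> mg; have sK : subfield (range iK) by apply: range_subfield; exact: setT_subfield.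
have sg := minpoly_size mg.
have sA : subfield (adjoin iK [set c]) by exact: field_gen_subfield.
have KA : range iK `<=` adjoin iK [set c] by move=> x Kx; apply: field_gen_ge; left.
have Ac : adjoin iK [set c] c by apply: field_gen_ge; right.
have bas : @is_basis _ _ iK (adjoin iK [set c]) (size g).-1 (fun i => c ^+ i).
  split=> [x|v v0].
    split=> [Ax|[v ->]]; last first.
      apply: (sf_sum sA) => i _; apply: (sfM sA); last exact: (sfX sA).
      by apply: KA; exists (v 0 i).
    have [h [Fh sh ->]] := adjoin_simple mg Ax.
    have /choice[k kP] i : exists k, iK k = h`_i by have [k _ e] := Fh i; exists k.
    exists (\row_i k i); rewrite (horner_coef_wide (n := (size g).-1)); last by lia.
    by apply: eq_bigr => i _; rewrite mxE kP.
  pose h := \poly_(i < (size g).-1) (if insub i is Some j then iK (v 0 j) else 0).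
  have h0 : h = 0.
    apply: (minpoly_small mg).
    - move=> i; rewrite coef_poly; case: ifP => _; last exact: (sf0 sK).
      by case: insubP => [j _ _|_]; [exists (v 0 j)|exact: (sf0 sK)].
    - apply/rootP; rewrite horner_poly -[RHS]v0; apply: eq_bigr => i _.
      by rewrite valK.
    - by apply: leq_ltn_trans (size_poly _ _) _; rewrite prednK // ltnW.
  apply/rowP => i; rewrite mxE; apply: (fmorph_inj iK); rewrite rmorph0.
  have := coef_poly (size g).-1 (fun i => if insub i is Some j then iK (v 0 j) else 0) i.
  by rewrite -/h h0 coef0 ltn_ord valK => <-.
have [b' bas'] : exists b, @is_basis _ _ iK (adjoin iK [set c]) (degree iK (adjoin iK [set c])) b.
  rewrite /degree; apply: (@xgetPex _ 0%N [set n | exists b, @is_basis _ _ iK _ n b]).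
  by exists (size g).-1, (fun i => c ^+ i).
by apply/eqP; rewrite eqn_leq (basis_le bas bas') (basis_le bas' bas).
Qed.

End Degree.

(** * Leading terms and minimal pairs *)

Section MinimalPair.
Variables (K : fieldType) (Kb : closedFieldType) (iK : {rmorphism K -> Kb}).
Hypothesis aK : algebraic_over (range iK).
Variables (G : oagType) (w : Kb -> ext G) (a : Kb) (gam : G).
Hypothesis dw : dval w.
Hypothesis min_a : forall a' : Kb, Fin gam <= w (a - a') ->
  (degree iK (adjoin iK [set a]) <= degree iK (adjoin iK [set a']))%N.

Lemma minimal_pair_sim a' h g : minpoly (range iK) a g -> polyIn (range iK) h ->
  h != 0 -> (size h < size g)%N -> Fin gam <= w (a - a') -> sim w h.[a] h.[a'].
Proof.
have sK : subfield (range iK) by apply: range_subfield; exact: setT_subfield.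
move=> mg Fh h0 sh aa'; have [l e] := closed_field_poly_normal h.
have lP z : z \in l -> w (a - z) < Fin gam.
  move=> zl; rewrite ltNge; apply/negP => /min_a.
  have [g' mg'] := minpoly_ex sK (aK z).
  rewrite (degree_adjoin mg) (degree_adjoin mg'); apply/negP; rewrite -ltnNge.
  have hz : root h z by rewrite e rootZ ?lead_coef_eq0 // root_prod_XsubC.
  have : (size g' <= size h)%N.
    rewrite leqNgt; apply/negP => lt; case/eqP: h0.
    exact: (minpoly_small mg').
  by move: sh (minpoly_size mg'); lia.
rewrite e !hornerZ !horner_prod; apply: simM => //.
  by apply: sim_refl => //; rewrite lead_coef_eq0.
elim: l {e} lP => [|z l IH] lP; first by rewrite !big_nil; apply: sim_refl; rewrite ?oner_eq0.
rewrite !big_cons; apply: simM => //; last by apply: IH => y yl; apply: lP; rewrite inE yl orbT.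
(* The factors a - z and a' - z differ by a - a', whose value is at least gam. *)
rewrite !hornerXsubC /sim opprB addrA subrK; apply: lt_le_trans aa'.
by apply: lP; rewrite inE eqxx.
Qed.

End MinimalPair.

(** * Valued function fields *)

Lemma fraction_ex (R : idomainType) (f : {fraction R}) :
  exists p q : R, q != 0 /\ f = FracField.tofrac p / FracField.tofrac q.
Proof.
elim/quotW: f => x; exists (frac x).1, (frac x).2; have d0 := denom_ratioP x; split=> //.
apply: (mulIf (_ : FracField.tofrac (frac x).2 != 0)); first by rewrite tofrac_eq0.
rewrite divfK ?tofrac_eq0 //; unlock FracField.tofrac.
rewrite -[LHS]FracField.pi_mul; apply/eqmodP; rewrite /= FracField.equivfE.
rewrite /FracField.mulf !numden_Ratio ?mulr1 ?oner_eq0 ?mulf_neq0 ?oner_eq0 //.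
by rewrite mulrC.
Qed.

Lemma preimage_subfield (A B : fieldType) (e : {rmorphism A -> B}) (L : set B) :
  subfield L -> subfield [set c | L (e c)].
Proof.
move=> sL; split; rewrite /=; first by rewrite rmorph1; exact: sf1.
- by move=> x y; rewrite rmorphB; exact: sfB.
- by move=> x y; rewrite fmorph_div; exact: sf_div.
Qed.

Lemma dval_comp (A B : fieldType) (G : oagType) (u : B -> ext G) (s : {rmorphism A -> B}) :
  dval u -> dval (u \o s).
Proof.
move=> [u0 uM uD]; split=> [x|x y|x y] /=.
- by rewrite u0 fmorph_eq0.
- by rewrite rmorphM uM.
- by rewrite rmorphD uD.
Qed.

Lemma maximal_subfield (Om : fieldType) (R A : set Om) y : subfield R -> A `<=` R -> ~ R y ->
  exists C, [/\ subfield C, A `<=` C, ~ C y &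
    forall D, subfield D -> C `<=` D -> ~ D y -> D `<=` C].
Proof.
move=> sR AR nRy; pose P C := C = set0 \/ [/\ subfield C, A `<=` C & ~ C y].
have [C [PC maxC]] : exists C, P C /\ forall D, C `<` D -> ~ P D.
  apply: Zorn_bigcup => F FP tot.
  have [[C0 FC0 [sC0 AC0 _]]|no] :=
      pselect (exists2 C, F C & [/\ subfield C, A `<=` C & ~ C y]); last first.
    left; apply/seteqP; split=> // z [C FC Cz].
    have [C0|h] := FP C FC; first by rewrite C0 in Cz.
    by exfalso; apply: no; exists C.
  have good C z : F C -> C z -> subfield C /\ ~ C y.
    by move=> FC Cz; have [C00|[]//] := FP C FC; rewrite C00 in Cz.
  have two z z' : (\bigcup_(X in F) X) z -> (\bigcup_(X in F) X) z' ->
      exists C, [/\ F C, subfield C, C z & C z'].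
    move=> [C FC Cz] [D FD Dz'].
    have [CD|DC] := tot C D FC FD.
      by exists D; split=> //; [case: (good _ _ FD Dz')|exact: CD].
    by exists C; split=> //; [case: (good _ _ FC Cz)|exact: DC].
  right; split.
  - split; first by exists C0 => //; exact: sf1.
    + move=> z z' a b; have [D [FD sD Da Db]] := two _ _ a b.
      by exists D => //; exact: (sfB sD).
    + move=> z z' a b; have [D [FD sD Da Db]] := two _ _ a b.
      by exists D => //; exact: (sf_div sD).
  - by move=> z /AC0 C0z; exists C0.
  - by move=> [C FC Cy]; have [_] := good C y FC Cy.
have [C0|[sC AC nCy]] := PC.
  exfalso; apply: (maxC R); last by right.
  by rewrite C0; split=> // R0; apply: (R0 1); exact: sf1.
exists C; split=> // D sD CD nDy; apply: contrapT => nDC.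
by apply: (maxC D); [split|right; split=> //; exact: subset_trans CD].
Qed.

(* Otherwise some z^q outside C is separable over C, and y = h(z^q) with h over C
   of degree less than that of z^q. As y^p is in C, all conjugates of z^q are
   roots of (h - y)^p, so h is constant. *)
Lemma maximal_purely_insep (Om : closedFieldType) (C : set Om) y p : subfield C ->
  algebraic_over C -> p \in [pchar Om] -> C (y ^+ p) -> ~ C y ->
  (forall D, subfield D -> C `<=` D -> ~ D y -> D `<=` C) ->
  forall z, exists2 q, [pchar Om].-nat q & C (z ^+ q).
Proof.
move=> sC aC pp Cyp nCy maxC z.
have [q [g [rs [qp mg eg urs]]]] := separable_power sC (aC z).
exists q => //; apply: contrapT => nCz; apply: nCy.
pose D := [set t | exists2 h, polyIn C h & t = h.[z ^+ q]].
have sD : subfield D by exact: simple_subfield mg.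
have CD : C `<=` D by move=> t Ct; exists t%:P; [exact: polyInC|rewrite hornerC].
have Dz : D (z ^+ q) by exists 'X; [exact: polyInX|rewrite hornerX].
have [h0 Ch0 ey0] : D y.
  by apply: contrapT => nDy; apply: nCz; exact: (maxC D).
have [h Ch [sh ey]] := minpoly_rem sC mg Ch0; rewrite -ey0 in ey.
have pn : [pchar Om].-nat p by rewrite pnatE ?(pcharf_prime pp).
have hr r : r \in rs -> h.[r] = y.
  move=> rrs; have [_ _ _ mi] := mg.
  have gr : root g r by rewrite eg root_prod_XsubC.
  have [||k _ ek] := mi (h ^+ p - (y ^+ p)%:P).
  - apply: polyInB => //; last exact: polyInC.
    by elim: (p) => [|n IH]; [exact: (polyInXn sC 0)|rewrite exprS; exact: polyInM].
  - by rewrite /root hornerD hornerN hornerC horner_exp ey subrr.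
  have : (h ^+ p - (y ^+ p)%:P).[r] = 0 by rewrite ek hornerM (rootP gr) mulr0.
  rewrite hornerD hornerN hornerC horner_exp -(exprNn_pchar _ pn) -exprDn_pchar //.
  by move=> /eqP; rewrite expf_eq0 subr_eq0 => /andP[_ /eqP].
have srs : size g = (size rs).+1 by rewrite eg size_prod_XsubC.
have eh : h - y%:P = 0.
  apply/eqP; apply: contraT => n0; have : (size rs < size (h - y%:P)%R)%N.
    apply: max_poly_roots => //; apply/allP => r /hr hry.
    by rewrite /root hornerD hornerN hornerC hry subrr.
  move=> lt; have := leq_trans lt (size_polyD _ _); rewrite size_polyN.
  move: (minpoly_size mg) sh (size_polyC_leq1 y); rewrite srs.
  by rewrite leq_max; move: (size h) (size rs) (size y%:P) => a b c; lia.
have := Ch 0%N; have -> : h = y%:P by apply/eqP; rewrite -subr_eq0 eh.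
by rewrite coefC.
Qed.

Section ValuedFunctionField.
Variables (K : fieldType) (Kb : closedFieldType) (iK : {rmorphism K -> Kb}).
Hypothesis Kb_algebraic : forall x : Kb, algebraicOver iK x.
Variables (G : oagType) (v : {fraction {poly Kb}} -> ext G).
Variables (Omega : closedFieldType) (j : {rmorphism {fraction {poly Kb}} -> Omega}).
Hypothesis O_algebraic : alg_closure_in (j @` base_field_X iK) = setT.
Variable w : Omega -> ext G.
Hypotheses (dw : dval w) (w_ext : forall f, w (j f) = v f).

Variables (jp : {rmorphism {poly Kb} -> Omega}) (e : {rmorphism Kb -> Omega}).
Hypotheses (jpE : forall p, jp p = j (FracField.tofrac p)).
Hypotheses (eE : forall c, e c = j (ratC c)).
Let x : Omega := j (ratX Kb).
Let KX : set Omega := j @` base_field_X iK.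
Let vb : Kb -> ext G := const_val v.

Lemma range_iK_subfield : subfield (range iK).
Proof. by apply: range_subfield; exact: setT_subfield. Qed.

Lemma Kb_algebraic_over : algebraic_over (range iK).
Proof.
move=> c; have [p p0 pc] := Kb_algebraic c; exists (map_poly iK p); split=> //.
  by rewrite map_poly_eq0.
by move=> i; rewrite coef_map; exists p`_i.
Qed.

Lemma KX_subfield : subfield KX.
Proof. by apply: range_subfield; exact: field_gen_subfield. Qed.

Lemma KX_const c : range iK c -> KX (e c).
Proof.
by move=> Kc; exists (ratC c); last exact/esym/eE; apply: field_gen_ge; left; exists c.
Qed.

Lemma KX_x : KX x.
Proof. by exists (ratX Kb) => //; apply: field_gen_ge; right. Qed.

Lemma KX_algebraic : algebraic_over KX.
Proof. by move=> y; rewrite /KX O_algebraic. Qed.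

Lemma const_val_dval : dval vb.
Proof.
have -> : vb = w \o e by apply/funext => c; rewrite /= eE w_ext.
exact: dval_comp.
Qed.

Lemma const_valE c : vb c = w (e c). Proof. by rewrite eE w_ext. Qed.

Lemma jp_eq0 p : (jp p == 0) = (p == 0).
Proof. by rewrite jpE fmorph_eq0 tofrac_eq0. Qed.

Lemma jpM p q : jp (p * q) = jp p * jp q. Proof. exact: rmorphM. Qed.
Lemma jpB p q : jp (p - q) = jp p - jp q. Proof. exact: rmorphB. Qed.
Lemma jp1 : jp 1 = 1. Proof. exact: rmorph1. Qed.
Lemma jp0 : jp 0 = 0. Proof. exact: rmorph0. Qed.

Lemma jpC c : jp c%:P = e c. Proof. by rewrite jpE eE. Qed.
Lemma jpX : jp 'X = x. Proof. by rewrite jpE. Qed.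

Lemma jpZ c p : jp (c *: p) = e c * jp p.
Proof. by rewrite -mul_polyC jpM jpC. Qed.

Lemma jp_XsubC c : jp ('X - c%:P) = x - e c.
Proof. by rewrite jpB jpC jpX. Qed.

Lemma x_sub_val c : v (ratX Kb - ratC c) = w (x - e c).
Proof. by rewrite -w_ext rmorphB eE. Qed.

Section Extend.
Variable t : {rmorphism Kb -> Kb}.
Hypothesis tK : aut_over (range iK) t.
Hypothesis tv : forall c, vb (t c) = vb c.
Hypothesis tx : forall c, w (x - e (t c)) = w (x - e c).

(** Polynomials split over Kb, so w on their images is determined by its values at constants and at
    the elements x - e c. *)
Lemma jp_map_val p : w (jp (map_poly t p)) = w (jp p).
Proof.
have [l ->] := closed_field_poly_normal p; rewrite map_polyZ !jpZ !dvalM //.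
congr (_ + _); first by rewrite -!const_valE tv.
have -> : map_poly t (\prod_(z <- l) ('X - z%:P)) = \prod_(z <- l) ('X - (t z)%:P).
  by rewrite rmorph_prod; apply: eq_bigr => z _; rewrite rmorphB /= map_polyX map_polyC.
elim: l => [|z l IH]; first by rewrite !big_nil.
by rewrite !big_cons !jpM !dvalM // IH !jp_XsubC tx.
Qed.

(** The coefficientwise action of t on Kb(X), as a graph inside Omega. *)
Definition frac_graph : set (Omega * Omega) := [set yz | exists p q, q != 0 /\
  (yz.1 = jp p / jp q /\ yz.2 = jp (map_poly t p) / jp (map_poly t q))].

Lemma frac_graphP : hom_graph frac_graph.
Proof.
have t0 p : p != 0 -> jp (map_poly t p) != 0 by rewrite jp_eq0 map_poly_eq0.
have j0 p : p != 0 -> jp p != 0 by rewrite jp_eq0.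
split.
- by exists 1, 1; rewrite oner_eq0 [map_poly t 1]rmorph1 jp1 divr1.
- move=> _ _ _ _ [p [q [q0 [/= -> ->]]]] [p' [q' [q'0 [/= -> ->]]]].
  exists (p * q' - p' * q), (q * q'); rewrite mulf_neq0 //; split=> //=.
  rewrite [map_poly t (_ - _)]rmorphB !jpB ![map_poly t (_ * _)]rmorphM !jpM; have := (t0 q q0, t0 q' q'0, j0 q q0, j0 q' q'0).
  by case=> [[[a b] c] f]; split; field; apply/andP.
- move=> _ _ _ _ [p [q [q0 [/= -> ->]]]] [p' [q' [q'0 [/= -> ->]]]].
  have [->|p'0] := eqVneq p' 0.
    by exists 0, 1; rewrite oner_eq0 /= !rmorph0 !mul0r !invr0 !mulr0.
  exists (p * q'), (q * p'); rewrite mulf_neq0 //; split=> //=.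
  rewrite ![map_poly t (_ * _)]rmorphM !jpM; have := (t0 q q0, t0 q' q'0, j0 q q0, j0 q' q'0).
  case=> [[[a b] c] f]; have := (t0 p' p'0, j0 p' p'0) => -[g h].
  by split; field; apply/and3P.
- move=> y [p [q [q0 [/= /esym/eqP + ->]]]].
  rewrite mulf_eq0 invr_eq0 !jp_eq0 (negbTE q0) orbF => /eqP ->.
  by rewrite !rmorph0 mul0r.
Qed.

(** An extension of the coefficientwise action to Omega need not preserve w, but w and its pullback
    agree on Kb(X), hence are conjugate over Kb(X). Correcting by the conjugating automorphism
    leaves the action on constants unchanged. *)
Lemma decomposition_extend :
  exists2 s, decomposition w KX s & forall c, s (e c) = e (t c).
Proof.
have gP p : frac_graph (jp p, jp (map_poly t p)).
  by exists p, 1; rewrite oner_eq0 [map_poly t 1]rmorph1 jp1 !divr1.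
have [T [hT gT dT]] := hom_graph_extend frac_graphP.
have jfrac f : exists2 g, frac_graph (j f, g) & w g = w (j f).
  have [p [q [q0 ->]]] := fraction_ex f.
  exists (jp (map_poly t p) / jp (map_poly t q)).
    by exists p, q; rewrite /= fmorph_div !jpE.
  have tq0 : jp (map_poly t q) != 0 by rewrite jp_eq0 map_poly_eq0.
  have jq0 : jp q != 0 by rewrite jp_eq0.
  rewrite fmorph_div -!jpE.
  apply: (@ext_addIr _ (w (jp q))); first exact: dval_neqInf.
  by rewrite /= -{1}jp_map_val -!dvalM // !divfK // jp_map_val.
have KXd : KX `<=` hom_dom frac_graph.
  by move=> _ [f _ <-]; have [g] := jfrac f; exists g.
have [s sP] : exists s : {rmorphism Omega -> Omega}, forall y, T (y, s y).
  by apply: hom_graph_total => // y; apply/dT/(algebraic_overS KXd KX_algebraic).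
have sg y z : frac_graph (y, z) -> s y = z.
  by move=> /gT; exact: (hg_fun hT (sP y)).
have se c : s (e c) = e (t c) by rewrite -!jpC (sg _ _ (gP c%:P)) map_polyC.
have sx : s x = x.
  by have := sg _ _ (gP 'X); rewrite map_polyX jpX.
have sKX : aut_over KX s.
  suff sub : base_field_X iK `<=` [set f | s (j f) = j f] by move=> _ [f /sub ? <-].
  apply: field_gen_le.
    have := subfield_eq (s \o j) j; apply.
  move=> f [[c Kc <-]|->]; last exact: sx.
  by rewrite /= -eE se tK.
have sub1 : subfield (range j) by apply: range_subfield; exact: setT_subfield.
have KXj : KX `<=` range j by move=> _ [f _ <-]; exists f.
have aj := algebraic_overS KXj KX_algebraic.
have eqj : equiv_on (range j) (w \o s) w.
  by move=> _ [f _ <-] /=; have [g /sg -> ->] := jfrac f.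
have [r rA rw] := vring_of_conjugate dw sub1 aj (dval_comp s dw) eqj.
have [r' [r'A rK r'K]] := aut_over_inv aj rA.
exists (s \o r').
  have sA : aut_over KX (s \o r').
    by apply: aut_over_comp => //; exact: aut_overS r'A.
  split=> //; apply: (dval_aut dw KX_algebraic sA) => y.
  by rewrite /vring_of /= -[w (s _)]/((w \o s) _) rw r'K.
by move=> c /=; rewrite r'A ?se // eE; exists (ratC c).
Qed.

End Extend.

(** The decomposition field over K(X) is one of the henselian fields whose intersection is the
    henselization, and t extends to the decomposition group. *)
Lemma fixed_of_IC t c : aut_over (range iK) t -> (forall c, vb (t c) = vb c) ->
  (forall c, w (x - e (t c)) = w (x - e c)) -> henselization w KX (e c) -> t c = c.
Proof.
move=> tK tv tx hc; have [s ds se] := decomposition_extend tK tv tx.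
have dc : decomposition_field w KX (e c).
  apply: hc; split; first exact: decomposition_field_sf.
    exact: decomposition_field_ge.
  exact: (decomposition_field_henselian dw KX_subfield KX_algebraic).
by apply: (fmorph_inj e); rewrite -se; exact: dc.
Qed.

Lemma e_algebraic (M : set Omega) c :
  (forall k, range iK k -> M (e k)) -> alg_closure_in M (e c).
Proof.
move=> KM; have [p [p0 Kp pc]] := Kb_algebraic_over c; exists (map_poly e p); split.
- by rewrite map_poly_eq0.
- by move=> i; rewrite coef_map; exact: KM.
- by rewrite /root horner_map fmorph_eq0.
Qed.

(** A homomorphism over M that sends y to z pulls w back to another extension of its restriction to
    M. As M is henselian, the two have the same ring, so the induced automorphism t of Kb preserves
    values. *)
Lemma henselian_move (M : set Omega) y z g : subfield M -> henselian w M ->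
  (forall k, range iK k -> M (e k)) -> minpoly M y g -> root g z ->
  exists t : {rmorphism Kb -> Kb}, [/\ aut_over (range iK) t, forall c, vb (t c) = vb c,
    forall c, M (e c) -> t c = c & forall c, y = e c -> z = e (t c)].
Proof.
move=> sM hM KM mg gz; have [S [hS MS Syz dS]] := hom_graph_move sM mg gz.
(* [henselian] quantifies over functions on all of Omega, so S is totalised by the default 0; only
   its values on the algebraic closure of M matter. *)
have /choice[f fP] y1 : exists y2, hom_dom S y1 -> S (y1, y2).
  have [[y2 Sy]|no] := pselect (hom_dom S y1); first by exists y2.
  by exists 0.
have f0 y1 : hom_dom S y1 -> (f y1 == 0) = (y1 == 0).
  move=> dy; have Sy := fP _ dy; apply/eqP/eqP => [fy|y10]; last first.
    by apply: (hg_fun hS Sy); rewrite y10; exact: hg00.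
  have [//|y10] := eqVneq y1 0; have := hg_div hS Sy Sy.
  rewrite divff // fy mul0r => S10.
  by have /eqP := hg_fun hS (hg1 hS) S10; rewrite oner_eq0.
have fu : valuation_on (alg_closure_in M) (w \o f).
  move=> y1 y2 /dS d1 /dS d2; have S1 := fP _ d1; have S2 := fP _ d2.
  have SM := hgM hS S1 S2; have SD := hgD hS S1 S2.
  have fM : f (y1 * y2) = f y1 * f y2.
    by apply: (hg_fun hS _ SM); apply: fP; exists (f y1 * f y2).
  have fD : f (y1 + y2) = f y1 + f y2.
    by apply: (hg_fun hS _ SD); apply: fP; exists (f y1 + f y2).
  have [_ _ wD] := dw.
  by rewrite /= fM fD dval_eqInf // f0 // dvalM //; split.
have fM y1 : M y1 -> f y1 = y1.
  by move=> My; apply: (hg_fun hS _ (MS _ My)); apply: fP; exists y1; exact: MS.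
have eqM : equiv_on M (w \o f) w by move=> y1 My /=; rewrite fM.
have eqa := hM G (w \o f) fu eqM.
have ea c : alg_closure_in M (e c) by exact: e_algebraic.
have [||||t tK tS] := @hom_graph_restrict Omega Kb e (range iK) S.
- exact: Kb_algebraic_over.
- exact: hS.
- by move=> c Kc; apply: MS; exact: KM.
- by move=> c; apply: dS.
exists t; split=> //.
- apply: (dval_aut const_val_dval Kb_algebraic_over tK) => c.
  rewrite /vring_of /= -/vb !const_valE -[w (e c)]/(w (e c)) -(eqa (e c) (ea c)) /=.
  by rewrite (hg_fun hS (fP _ (dS _ (ea c))) (tS c)).
- by move=> c Mc; apply: (fmorph_inj e); apply: (hg_fun hS (tS c)); exact: MS.
- by move=> c ey; rewrite ey in Syz; exact: (hg_fun hS Syz (tS c)).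
Qed.

Lemma insep_henselian (C : set Omega) : subfield C -> algebraic_over C ->
  (forall z, exists2 q, [pchar Omega].-nat q & C (z ^+ q)) -> henselian w C.
Proof.
move=> sC aC pC G' u /(valuation_on_total aC) du e' y _; have [q qp Cy] := pC y.
by have := e' _ Cy; rewrite !dvalX // !ext_ge0Mn // (pchar_nat_gt0 qp).
Qed.

Lemma IC_power_closed (M : set Omega) y p : subfield M ->
  (forall k, range iK k -> M (e k)) -> p \in [pchar Omega] -> M (e y ^+ p) ->
  henselization w KX (e y) -> M (e y).
Proof.
move=> sM KM pp Myp hy; apply: contrapT => nMy.
pose M1 : set Kb := [set c | M (e c)].
have sM1 : subfield M1 by exact: preimage_subfield.
(* R is the field M1(X). It contains K(X) and the p-th power of y, but not y, so the search for a
   maximal such field has a starting point. *)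
pose R : set Omega := [set z | exists p q, [/\ polyIn M1 p, polyIn M1 q, q != 0 &
  z = jp p / jp q]].
have j0 r : r != 0 -> jp r != 0 by rewrite jp_eq0.
have sR : subfield R.
  split.
  - exists 1, 1; rewrite oner_eq0 jp1 divr1; split=> //; exact: (polyInXn sM1 0).
  - move=> _ _ [a [b [Ma Mb b0 ->]]] [c [d [Mc Md d0 ->]]].
    exists (a * d - c * b), (b * d); split.
    + by apply: (polyInB sM1); apply: (polyInM sM1).
    + exact: (polyInM sM1).
    + by rewrite mulf_neq0.
    + by rewrite jpB !jpM; field; rewrite !j0.
  - move=> _ _ [a [b [Ma Mb b0 ->]]] [c [d [Mc Md d0 ->]]].
    have [->|c0] := eqVneq c 0.
      exists 0, 1; rewrite oner_eq0 jp0 !mul0r invr0 mulr0; split=> //; first exact: (polyIn0 sM1).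
      exact: (polyInXn sM1 0).
    exists (a * d), (b * c); split; [exact: (polyInM sM1)|exact: (polyInM sM1)|by rewrite mulf_neq0|].
    by rewrite !jpM; field; rewrite !j0.
have Rconst c : M1 c -> R (e c).
  move=> Mc; exists c%:P, 1; rewrite oner_eq0 jp1 divr1 jpC; split=> //.
    exact: (polyInC sM1).
  exact: (polyInXn sM1 0).
have Rx : R x.
  exists 'X, 1; rewrite oner_eq0 jp1 divr1 jpX; split=> //; first exact: (polyInX sM1).
  exact: (polyInXn sM1 0).
have KXR : KX `<=` R.
  suff sub : base_field_X iK `<=` [set f | R (j f)] by move=> _ [f /sub ? <-].
  apply: field_gen_le; first exact: preimage_subfield.
  move=> f [[c Kc <-]|->]; last exact: Rx.
  by rewrite /= -eE; apply: Rconst; exact: KM.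
have nRy : ~ R (e y).
  move=> [a [b [Ma Mb b0 ey]]]; apply: nMy.
  (* The equation takes place between polynomials over Kb; comparing coefficients at the degree of b
     puts y in M1. *)
  have eab : y *: b = a.
    apply/eqP; rewrite -subr_eq0 -jp_eq0 jpB jpZ ey divfK ?subrr ?eqxx //.
    exact: j0.
  have lb : lead_coef b != 0 by rewrite lead_coef_eq0.
  have -> : y = a`_(size b).-1 / b`_(size b).-1.
    by rewrite -eab coefZ mulfK.
  by have := sf_div sM1 (Ma (size b).-1) (Mb (size b).-1).
pose C0 : set Omega := KX `|` [set e y ^+ p].
have C0R : C0 `<=` R.
  move=> z [/KXR//|->]; rewrite -rmorphXn; apply: Rconst.
  by rewrite /M1 /= rmorphXn.
have [C [sC C0C nCy maxC]] := maximal_subfield sR C0R nRy.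
have KXC : KX `<=` C by move=> z KXz; apply: C0C; left.
have aC := algebraic_overS KXC KX_algebraic.
have Cyp : C (e y ^+ p) by apply: C0C; right.
have hC := insep_henselian sC aC (maximal_purely_insep sC aC pp Cyp nCy maxC).
by apply: nCy; apply: hy; split.
Qed.

(** The approximating sequence enters only through the hypothesis that the automorphisms t preserve
    all values w (x - e c). *)
Lemma IC_sub (M : set Omega) y : subfield M -> henselian w M ->
  (forall k, range iK k -> M (e k)) ->
  (forall t, aut_over (range iK) t -> (forall c, vb (t c) = vb c) ->
    (forall c, M (e c) -> t c = c) -> forall c, w (x - e (t c)) = w (x - e c)) ->
  henselization w KX (e y) -> M (e y).
Proof.
move=> sM hM KM MX hy.
have [[q qp Mq]|[q [g [z [qp mg gz zy]]]]] := power_or_other sM (e_algebraic y KM); last first.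
  exfalso; have [t [tK tv tM tz]] := henselian_move sM hM KM mg gz.
  have := tz (y ^+ q); rewrite rmorphXn /= => /(_ erefl) ez.
  by case/eqP: zy; rewrite ez !rmorphXn (fixed_of_IC tK tv (MX t tK tv tM) hy).
elim: q.+1 {-2}q (ltnSn q) y hy qp Mq => // {q}n IH q qn y hy qp Mq.
have [q1|q1] := leqP q 1.
  have eq1 : q = 1%N by apply/eqP; rewrite eqn_leq q1 (pchar_nat_gt0 qp).
  by move: Mq; rewrite eq1 expr1.
have prp := pdiv_prime q1; have pq := pdiv_dvd q.
have pp : pdiv q \in [pchar Omega] by rewrite -(pnatE _ prp); exact: pnat_dvd pq qp.
have eq : q = (q %/ pdiv q * pdiv q)%N by rewrite divnK.
(* The exponent loses one prime factor p at a time: y^(q/p) has its p-th power in M, so it is in M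
   itself. *)
apply: (IH (q %/ pdiv q)%N) => //.
- by apply: leq_trans (ltn_Pdiv (prime_gt1 prp) (pchar_nat_gt0 qp)) _; rewrite -ltnS.
- by apply: pnat_dvd qp; exact: dvdn_div.
rewrite -rmorphXn; apply: IC_power_closed pp _ _ => //.
  by rewrite rmorphXn /= -exprM -eq.
by move=> L LP; rewrite rmorphXn; apply: sfX; [case: LP|exact: hy].
Qed.

Lemma tame_in_henselian (L : set Omega) a b gam : subfield L -> KX `<=` L -> henselian w L ->
  w (x - e a) = Fin gam ->
  (forall a', Fin gam <= vb (a - a') ->
    (degree iK (adjoin iK [set a]) <= degree iK (adjoin iK [set a']))%N) ->
  adjoin iK [set a] b -> ramification_field iK vb b -> L (e b).
Proof.
move=> sL KXL hL xa min_a ab [[p [_ pb sp]] rb]; have dvb := const_val_dval.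
have KL k : range iK k -> L (e k) by move=> /KX_const/KXL.
pose pL := map_poly (e \o iK) p.
have Lp : polyIn L pL by move=> i; rewrite coef_map; apply: KL; exists p`_i.
have spL : separable_poly pL by rewrite separable_map.
have pLb : root pL (e b) by rewrite /pL map_poly_comp /root horner_map fmorph_eq0.
have [//|[g [mg [z gz zb]]]] := separable_other sL Lp spL pLb.
exfalso; have aL := algebraic_overS KXL KX_algebraic.
have [s sA sz] := aut_move sL aL mg gz.
(* The pullback of w by s agrees with w on L, so henselianity gives the same ring, hence the same
   values by finiteness of orbits. *)
have ws : forall y, w (s y) = w y.
  apply: (dval_aut dw aL sA) => y.
  have val : valuation_on (alg_closure_in L) (w \o s).
    by move=> y1 y2 _ _; exact: ((valuationP (w \o s)).2 (dval_comp s dw) y1 y2 I I).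
  have eqL : equiv_on L (w \o s) w by move=> y1 Ly /=; rewrite sA.
  by rewrite /vring_of /= -(hL G _ val eqL y (aL y)).
have [|||t tK ts] := @hom_graph_restrict Omega Kb e (range iK) _ _ (rmorphism_graph s).
- exact: Kb_algebraic_over.
- by move=> c Kc /=; rewrite sA //; exact: KL.
- by move=> c; exists (s (e c)).
have {}ts c : e (t c) = s (e c) by exact: (ts c).
have tv c : vb (t c) = vb c by rewrite !const_valE ts ws.
have sK := range_iK_subfield.
have at' : Fin gam <= vb (a - t a).
  have sx : s x = x by apply: sA; apply: KXL; exact: KX_x.
  rewrite const_valE rmorphB ts.
  (* As s fixes x, this is a difference of two elements of value gam. *)
  have -> : e a - s (e a) = s (x - e a) - (x - e a).
    by rewrite rmorphB sx opprB [RHS]addrC addrA addrNK.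
  by rewrite dval_leB // ?ws xa.
have [ga mga] := minpoly_ex sK (Kb_algebraic_over a).
have simA y : adjoin iK [set a] y -> y != 0 -> sim vb y (t y).
  move=> /(adjoin_simple mga)[h [Fh sh ->]] hy.
  have h0 : h != 0 by apply: contraNneq hy => ->; rewrite horner0.
  have -> : t h.[a] = h.[t a].
    rewrite -horner_map; congr (_.[_]); apply/polyP => i.
    by rewrite coef_map /= tK.
  exact: (minimal_pair_sim Kb_algebraic_over dvb min_a mga Fh h0 sh at').
have sA' : subfield (adjoin iK [set a]) by exact: field_gen_subfield.
have KA : range iK `<=` adjoin iK [set a] by move=> y Ky; apply: field_gen_ge; left.
have [f [h [fA hK tfh simh]]] := ramification_factor dvb sK sA' KA Kb_algebraic_over
  (conj tK tv : decomposition vb (range iK) t) simA.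
have hR : ramification_group iK vb h.
  split; last by move=> y _ /simh; rewrite /sim -opprB dvalN.
  split; last by move=> k; apply: hK; exists k.
  have [h' [_ hh' h'h]] := aut_over_inv Kb_algebraic_over hK.
  by exists h'.
by case/eqP: zb; rewrite -sz -ts tfh (rb h hR) fA.
Qed.

End ValuedFunctionField.

(** An algebraically closed field is its own algebraic closure, so there is nothing to extend. This
    keeps the henselization of a field of constants inside the constants. *)
Lemma closed_image_henselian (A Om : closedFieldType) (e : {rmorphism A -> Om}) (G : oagType)
  (w : Om -> ext G) : henselian w (range e).
Proof.
move=> G' u _ eu y [p [p0 ep py]]; apply: eu.
have /choice[c cP] i : exists c, e c = p`_i by have [c _ ec] := ep i; exists c.
pose p' := \poly_(i < size p) c i.
have epp : p = map_poly e p'.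
  apply/polyP => i; rewrite coef_map /= coef_poly; case: ltnP => [_|le]; first by rewrite cP.
  by rewrite rmorph0 nth_default.
apply: (@image_root _ _ e p'); last by rewrite -epp.
by apply: contraNneq p0 => p'0; rewrite epp p'0 rmorph0.
Qed.

Theorem theorem6p2
  (K : fieldType) (Kb : closedFieldType) (iK : {rmorphism K -> Kb})
  (Kb_algebraic : forall x : Kb, algebraicOver iK x)
  (G : oagType) (v : {fraction {poly Kb}} -> ext G) (v_val : valuation v)
  (v_alg : valuation_algebraic v (base_field iK) (base_field_X iK))
  (Omega : closedFieldType) (j : {rmorphism {fraction {poly Kb}} -> Omega})
  (O_algebraic : alg_closure_in (j @` base_field_X iK) = setT)
  (w : Omega -> ext G) (w_val : valuation w) (w_ext : forall f, w (j f) = v f)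
  (d : Order.disp_t) (I : orderType d) (I_limit : limit_ordinal I)
  (gamma : I -> G) (a b : I -> Kb)
  (gamma_in : forall nu, exists c, v (ratX Kb - ratC c) = Fin (gamma nu))
  (gamma_incr : forall nu mu : I, (nu < mu)%O -> gamma nu < gamma mu)
  (gamma_cofinal : forall c, exists nu,
     v (ratX Kb - ratC c) <= Fin (gamma nu))
  (a_gamma : forall nu, v (ratX Kb - ratC (a nu)) = Fin (gamma nu))
  (a_minimal : forall nu, minimal_pair_of_definition iK v
     (mono_val v (a nu) (gamma nu)) (a nu) (gamma nu))
  (a_conj : forall nu (s : {rmorphism Kb -> Kb}), galK iK s ->
     v (ratX Kb - ratC (s (a nu))) <= v (ratX Kb - ratC (a nu)))
  (b_a : forall nu, adjoin iK [set b nu] =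
     adjoin iK [set a nu] `&` ramification_field iK (const_val v)) :
  let emb := fun c : Kb => j (ratC c) in
  henselization w (emb @` adjoin iK (range b))
    `<=` implicit_constant_field iK j w /\
  implicit_constant_field iK j w
    `<=` henselization w (emb @` adjoin iK (range a)).
Proof.
move=> emb; have dw := (valuationP w).1 w_val.
pose jp : {rmorphism {poly Kb} -> Omega} := j \o @FracField.tofrac {poly Kb}.
pose e : {rmorphism Kb -> Omega} := jp \o polyC.
have jpE p : jp p = j (FracField.tofrac p) by [].
have eE c : e c = j (ratC c) by [].
have xE c := x_sub_val w_ext eE c.
have sadj S : subfield (adjoin iK S) by exact: field_gen_subfield.
split.
  move=> y hy; split.
    have [c _ <-] : range e y; last by exists c.
    apply: hy; split; first by apply: range_subfield; exact: setT_subfield.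
      by move=> _ [c _ <-]; exists c.
    exact: closed_image_henselian.
  move=> L [sL KXL hL]; apply: hy; split=> //.
  suff sub : adjoin iK (range b) `<=` [set c | L (e c)] by move=> _ [c /sub ? <-].
  apply: field_gen_le.
    exact: preimage_subfield.
  move=> c [Kc|[nu _ <-]]; first by apply: KXL; exact: (KX_const eE Kc).
  have [ab rb] : (adjoin iK [set a nu] `&` ramification_field iK (const_val v)) (b nu).
    by rewrite -b_a; apply: field_gen_ge; right.
  have [_ min_a] := a_minimal nu.
  by apply: (tame_in_henselian Kb_algebraic O_algebraic dw w_ext eE sL KXL hL _ min_a ab rb);
    rewrite -xE a_gamma.
move=> y [[c _ <-] hy] M [sM aM hM].
have KM k : range iK k -> M (e k).
  by move=> Kk; apply: aM; exists k => //; apply: field_gen_ge; left.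
apply: (IC_sub Kb_algebraic O_algebraic dw w_ext jpE eE sM hM KM _ hy) => t tK tv tM z.
(* Cofinality gives only a weak inequality; as there is no last index, a later nu makes it
   strict. *)
have [nu0 le0] := gamma_cofinal z; have [_ _ /(_ nu0)[nu lt0]] := I_limit.
have lt : w (j (ratX Kb) - e z) < w (j (ratX Kb) - e (a nu)).
  by rewrite -!xE a_gamma; apply: le_lt_trans le0 _; rewrite lt_Fin; exact: gamma_incr.
have ta : t (a nu) = a nu.
  by apply: tM; apply: aM; exists (a nu) => //; apply: field_gen_ge; right; exists nu.
(* Since a_nu is strictly closer to X than z is, v(X - z) = v(a_nu - z), a value of constants that t
   preserves while fixing a_nu. *)
have az : w (e (a nu) - e z) = w (j (ratX Kb) - e z).
  have -> : e (a nu) - e z = (j (ratX Kb) - e z) - (j (ratX Kb) - e (a nu)).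
    by rewrite opprB [RHS]addrC addrA subrK.
  by rewrite dval_eqD // dvalN.
have atz : w (e (a nu) - e (t z)) = w (e (a nu) - e z).
  rewrite -!rmorphB -{1}ta -rmorphB.
  by rewrite -!(const_valE w_ext eE) tv.
have -> : j (ratX Kb) - e (t z) = (e (a nu) - e (t z)) + (j (ratX Kb) - e (a nu)).
  by rewrite [RHS]addrC addrA subrK.
by rewrite dval_eqD // atz az.
Qed.
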